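(* For any space $X$ and point $x\in X$, the following are equivalent: (1) for every map $f:(\mathbb{H},b_0)\to(X,x)$ there exists a homomorphism $g:\pi_1(\mathbb{T},x_0)\to\pi_1(X,x)$ with $f_\#=g\circ\eta_\#$; (2) $X$ is transfinitely $\pi_1$-commutative at $x$; (3) $X$ is infinitely $\pi_1$-commutative at $x$.
   Context: $I=[0,1]$; $\Omega(X,x)$ is the space of loops at $x$. Let $C_n\subset\mathbb{R}^2$ be the circle of radius $1/n$ centered at $(1/n,0)$, $\mathbb{H}=\bigcup_nC_n$ the Hawaiian earring with basepoint $b_0=(0,0)$, $\ell_n$ the counterclockwise loop around $C_n$ based at $b_0$. A sequence $\alpha_n\in\Omega(X,x)$ is a null-sequence if each neighborhood of $x$ contains $\mathrm{Im}(\alpha_n)$ for all but finitely many $n$; null-sequences correspond bijectively to maps $f:(\mathbb{H},b_0)\to(X,x)$ via $f\circ\ell_n=\alpha_n$. Let $\ell_\infty$ be the loop in $\mathbb{H}$ equal to $\ell_n$ (linearly reparametrized) on $[\frac{n-1}{n},\frac{n}{n+1}]$ with $\ell_\infty(1)=b_0$. Let $\mathcal{C}\subseteq I$ be the middle-thirds Cantor set and write $I\setminus\mathcal{C}=\bigcup_{n\geq1}\bigcup_{k=1}^{2^{n-1}}I_n^k$ where $I_n^k$ are the open intervals of length $3^{-n}$, indexed for fixed $n$ in their left-to-right order; $\ell_\tau$ is the loop with $\ell_\tau(\mathcal{C})=b_0$ that equals (a linear reparametrization of) $\ell_{2^{n-1}+k-1}$ on $\overline{I_n^k}$. For a null-sequence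 $\{\alpha_n\}$ with associated map $f$, $\prod_{n=1}^\infty\alpha_n:=f\circ\ell_\infty$ and $\prod_\tau\alpha_n:=f\circ\ell_\tau$. $X$ is infinitely (resp. transfinitely) $\pi_1$-commutative at $x$ if for every null-sequence $\alpha_n\in\Omega(X,x)$ and every bijection $\phi:\mathbb{N}\to\mathbb{N}$, $[\prod_{n=1}^\infty\alpha_n]=[\prod_{n=1}^\infty\alpha_{\phi(n)}]$ (resp. $[\prod_\tau\alpha_n]=[\prod_\tau\alpha_{\phi(n)}]$) in $\pi_1(X,x)$. $\mathbb{T}=\prod_{n\in\mathbb{N}}S^1$ with basepoint $x_0$, and $\eta:\mathbb{H}\to\mathbb{T}$ is the embedding onto $\bigvee_nS^1$ sending $C_n$ to the $n$-th circle factor; $\pi_1(\mathbb{T},x_0)\cong\mathbb{Z}^{\mathbb{N}}$. *)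

(* Defs.v *)
From Stdlib Require Import Reals Lra ClassicalEpsilon.
Open Scope R_scope.

Definition is_topology {X : Type} (opn : (X -> Prop) -> Prop) : Prop :=
  opn (fun _ => True) /\
  (forall F : (X -> Prop) -> Prop, (forall U, F U -> opn U) ->
      opn (fun p => exists U, F U /\ U p)) /\
  (forall U V, opn U -> opn V -> opn (fun p => U p /\ V p)).

Definition metric_open {A : Type} (d : A -> A -> R) (U : A -> Prop) : Prop :=
  forall a, U a -> exists eps, 0 < eps /\ forall b, d a b < eps -> U b.

Definition I := {t : R | 0 <= t <= 1}.
Lemma I0_prf : 0 <= 0 <= 1. Proof. lra. Qed.
Lemma I1_prf : 0 <= 1 <= 1. Proof. lra. Qed.
Definition I0 : I := exist _ 0 I0_prf.
Definition I1 : I := exist _ 1 I1_prf.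
Lemma clamp_prf (r : R) : 0 <= Rmin 1 (Rmax 0 r) <= 1.
Proof. split; [apply Rmin_glb; [lra | apply Rmax_l] | apply Rmin_l]. Qed.
(** the point of I closest to r (used only for r already in [0,1]) *)
Definition clampI (r : R) : I := exist _ (Rmin 1 (Rmax 0 r)) (clamp_prf r).

Definition dI (s t : I) : R := Rabs (proj1_sig s - proj1_sig t).
Definition dII (p q : I * I) : R :=
  Rmax (dI (fst p) (fst q)) (dI (snd p) (snd q)).

(** * Loops, homotopy of loops, concatenation, in a subspace S of an
    ambient space (Y, opn) with base point y.  For an abstract space X one
    takes S := fun _ => True. *)
Definition is_loop {Y : Type} (opn : (Y -> Prop) -> Prop) (S : Y -> Prop)
  (y : Y) (g : I -> Y) : Prop :=
  (forall t, S (g t)) /\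
  (forall U, opn U -> metric_open dI (fun t => U (g t))) /\
  g I0 = y /\ g I1 = y.

Definition homotopic {Y : Type} (opn : (Y -> Prop) -> Prop) (S : Y -> Prop)
  (y : Y) (g h : I -> Y) : Prop :=
  exists H : I * I -> Y,
    (forall p, S (H p)) /\
    (forall U, opn U -> metric_open dII (fun p => U (H p))) /\
    (forall s, H (s, I0) = g s) /\ (forall s, H (s, I1) = h s) /\
    (forall t, H (I0, t) = y /\ H (I1, t) = y).

Definition concat {Y : Type} (g h : I -> Y) : I -> Y := fun t =>
  if Rle_dec (proj1_sig t) (1/2) then g (clampI (2 * proj1_sig t))
  else h (clampI (2 * proj1_sig t - 1)).

Definition dR2 (p q : R * R) : R :=
  sqrt ((fst p - fst q) ^ 2 + (snd p - snd q) ^ 2).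
Definition R2_open : (R * R -> Prop) -> Prop := metric_open dR2.
Definition on_C (n : nat) (p : R * R) : Prop :=
  (fst p - / INR n) ^ 2 + (snd p) ^ 2 = (/ INR n) ^ 2.
Definition inHE (p : R * R) : Prop := exists n, (1 <= n)%nat /\ on_C n p.
Definition b0 : R * R := (0, 0).

Definition HE_map_cont {X : Type} (opn : (X -> Prop) -> Prop)
  (f : R * R -> X) : Prop :=
  forall U, opn U -> forall p, inHE p -> U (f p) ->
    exists eps, 0 < eps /\ forall q, inHE q -> dR2 p q < eps -> U (f q).

(** * The torus T = prod_{n in N} S^1, inside (R^2)^N with product topology.
    Coordinate k (k : nat, starting at 0) is the (k+1)-th circle factor. *)
Definition on_S1 (p : R * R) : Prop := fst p ^ 2 + snd p ^ 2 = 1.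
Definition inT (u : nat -> R * R) : Prop := forall k, on_S1 (u k).
Definition T_open (U : (nat -> R * R) -> Prop) : Prop :=
  forall u, U u -> exists (N : nat) (eps : R), 0 < eps /\
    forall v, (forall k, (k < N)%nat -> dR2 (u k) (v k) < eps) -> U v.
Definition x0 : nat -> R * R := fun _ => (-1, 0).

(** eta : H -> T, embedding onto the wedge; C_{k+1} is sent onto the k-th
    factor by p |-> (k+1) * (p - (1/(k+1), 0)), so b0 |-> x0. *)
Definition eta (p : R * R) : nat -> R * R := fun k =>
  if Req_EM_T ((fst p - / INR (S k)) ^ 2 + (snd p) ^ 2) ((/ INR (S k)) ^ 2)
  then (INR (S k) * fst p - 1, INR (S k) * snd p)
  else (-1, 0).

Definition cond_factor {X : Type} (opn : (X -> Prop) -> Prop) (x : X) : Prop :=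
  forall f : R * R -> X, HE_map_cont opn f -> f b0 = x ->
  exists g : (I -> nat -> R * R) -> (I -> X),
    (* g induces a homomorphism pi_1(T,x0) -> pi_1(X,x) *)
    (forall a, is_loop T_open inT x0 a -> is_loop opn (fun _ => True) x (g a)) /\
    (forall a b, is_loop T_open inT x0 a -> is_loop T_open inT x0 b ->
       homotopic T_open inT x0 a b -> homotopic opn (fun _ => True) x (g a) (g b)) /\
    (forall a b, is_loop T_open inT x0 a -> is_loop T_open inT x0 b ->
       homotopic opn (fun _ => True) x (g (concat a b)) (concat (g a) (g b))) /\
    (forall c, is_loop R2_open inHE b0 c ->
       homotopic opn (fun _ => True) x (fun t => f (c t)) (g (fun t => eta (c t)))).

(** * Null sequences and infinite products.
    Sequences are indexed from 0: alpha k is the paper's alpha_{k+1}. *)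
Definition null_seq {X : Type} (opn : (X -> Prop) -> Prop) (x : X)
  (alpha : nat -> I -> X) : Prop :=
  (forall n, is_loop opn (fun _ => True) x (alpha n)) /\
  (forall U, opn U -> U x -> exists N, forall n, (N <= n)%nat -> forall t, U (alpha n t)).

Definition piece_inf (t : R) (n : nat) : Prop :=
  (1 <= n)%nat /\ (INR n - 1) / INR n <= t < INR n / (INR n + 1).

Definition prod_inf {X : Type} (x : X) (alpha : nat -> I -> X) : I -> X :=
  fun t =>
  match excluded_middle_informative (exists n, piece_inf (proj1_sig t) n) with
  | left H =>
      let n := proj1_sig (constructive_indefinite_description _ H) in
      let a := (INR n - 1) / INR n in
      let b := INR n / (INR n + 1) in
      alpha (n - 1)%nat (clampI ((proj1_sig t - a) / (b - a)))
  | right _ => x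
  end.

(** ccode m k: replace the binary digits of k (m digits) by ternary digits 0/2 *)
Fixpoint ccode (m k : nat) : nat :=
  match m with
  | O => O
  | S m' => (2 * (k mod 2) + 3 * ccode m' (k / 2))%nat
  end.

(** left endpoint of I_n^k (the k-th, left to right, removed open interval
    of length 3^-n of the middle-thirds Cantor set) *)
Definition Lcan (n k : nat) : R :=
  INR (3 * ccode (n - 1) (k - 1) + 1) / 3 ^ n.

Definition piece_tau (t : R) (nk : nat * nat) : Prop :=
  (1 <= fst nk)%nat /\ (1 <= snd nk <= 2 ^ (fst nk - 1))%nat /\
  Lcan (fst nk) (snd nk) <= t <= Lcan (fst nk) (snd nk) + / 3 ^ (fst nk).

(** prod_tau alpha_n = f o ell_tau: alpha_{2^{n-1}+k-1} on closure of I_n^k,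
    x on the Cantor set *)
Definition prod_tau {X : Type} (x : X) (alpha : nat -> I -> X) : I -> X :=
  fun t =>
  match excluded_middle_informative (exists nk, piece_tau (proj1_sig t) nk) with
  | left H =>
      let nk := proj1_sig (constructive_indefinite_description _ H) in
      let n := fst nk in let k := snd nk in
      alpha (2 ^ (n - 1) + k - 2)%nat
            (clampI ((proj1_sig t - Lcan n k) * 3 ^ n))
  | right _ => x
  end.

Definition bijective_nat (phi : nat -> nat) : Prop :=
  (forall m n, phi m = phi n -> m = n) /\ (forall n, exists m, phi m = n).

Definition inf_comm {X : Type} (opn : (X -> Prop) -> Prop) (x : X) : Prop :=
  forall alpha, null_seq opn x alpha -> forall phi, bijective_nat phi ->
    homotopic opn (fun _ => True) x (prod_inf x alpha)
              (prod_inf x (fun n => alpha (phi n))).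

Definition transf_comm {X : Type} (opn : (X -> Prop) -> Prop) (x : X) : Prop :=
  forall alpha, null_seq opn x alpha -> forall phi, bijective_nat phi ->
    homotopic opn (fun _ => True) x (prod_tau x alpha)
              (prod_tau x (fun n => alpha (phi n))).

(* Main.v *)
Require Import Defs.
From Stdlib Require Import Reals.
From Stdlib Require Import Lra Lia Psatz ClassicalEpsilon ProofIrrelevance.
From Stdlib Require Import FunctionalExtensionality Cantor PeanoNat ZArith.
Local Open Scope R_scope.

(** (1) => (2). In the torus, a product of the circle loops l_n, placed along any family of disjoint
    intervals, is homotopic coordinate by coordinate to any other placement; a homomorphism g with
    f_# = g o eta_# carries this to X.
    (2) => (3). The rightmost intervals of each level of the Cantor set have order type omega, so an
    omega-product is a tau-product with constant loops in all other places.
    (3) => (1). The key fact is that a loop F in X is homotopic to the omega-product of its pieces over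
    any sequence of disjoint intervals outside which F is constant, whatever their order type. Hence
    infinite products do not depend on the placement of their factors. The homomorphism g sends a
    loop a of T to the product over k of the loops f (a_k), where a_k is the k-th coordinate of a seen
    as a loop in C_k. No winding number is needed: g is compatible with concatenation because
    both sides are products of the same factors, and f o c ~ g (eta o c) because both sides are
    products of the restrictions of f o c to the components of the preimages of the open arcs. *)

(** Infinite commutativity only permutes sequences of order type omega, whereas the pieces of a loop
    may lie in any countable order, even a dense one, and no reparametrization of [I] turns one
    order type into another. The passage is a swindle. Erasing the pieces one after the other writes
    the loop as an omega-product of quotients of successive remainders, and each quotient is a
    conjugate of one piece. A single permutation, the exchange of neighbours, removes all the
    conjugations at once. Such a step runs infinitely many homotopies side by side. Continuity of
    the result is secured by confining the n-th one to a set that shrinks to [x]; this is why the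
    algebra of paths is developed inside a subset [S], and why each cancellation takes place in the
    image of the loops involved. In the torus the situation is easier: a coordinate sees only its
    own circle, so intervals may slide through each other while their order changes. *)

Local Notation val t := (proj1_sig t).
Local Notation val1 p := (proj1_sig (@fst I I p)).
Local Notation val2 p := (proj1_sig (@snd I I p)).

(** * Case splits for minima and maxima, and the clamped unit interval *)

Lemma Rmin_cases (a b : R) : (a <= b /\ Rmin a b = a) \/ (b < a /\ Rmin a b = b).
Proof. unfold Rmin; destruct Rle_dec; [left | right]; lra. Qed.

Lemma Rmax_cases (a b : R) : (a <= b /\ Rmax a b = b) \/ (b < a /\ Rmax a b = a).
Proof. unfold Rmax; destruct Rle_dec; [left | right]; lra. Qed.

Ltac no_minmax a :=
  lazymatch a with
  | context [Rmin _ _] => fail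
  | context [Rmax _ _] => fail
  | _ => idtac
  end.

(* Innermost occurrences are split first, so that the new hypotheses are linear. *)
Ltac minmax :=
  repeat match goal with
  | |- context [Rmin ?a ?b] =>
      no_minmax a; no_minmax b; destruct (Rmin_cases a b) as [[? ->]|[? ->]]
  | |- context [Rmax ?a ?b] =>
      no_minmax a; no_minmax b; destruct (Rmax_cases a b) as [[? ->]|[? ->]]
  end; try lra.

Lemma I_eq (s t : I) : val s = val t -> s = t.
Proof. apply eq_sig_hprop. intros; apply proof_irrelevance. Qed.

Lemma I_bounds (t : I) : 0 <= val t <= 1.
Proof. exact (proj2_sig t). Qed.

Lemma val_clampI (r : R) : 0 <= r <= 1 -> val (clampI r) = r.
Proof. intros; simpl; unfold Rmin, Rmax; repeat destruct Rle_dec; lra. Qed.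

Lemma clampI_val (t : I) : clampI (val t) = t.
Proof. apply I_eq, val_clampI, I_bounds. Qed.

Lemma clampI_le0 (r : R) : r <= 0 -> clampI r = I0.
Proof. intros; apply I_eq; simpl; unfold Rmin, Rmax; repeat destruct Rle_dec; lra. Qed.

Lemma clampI_ge1 (r : R) : 1 <= r -> clampI r = I1.
Proof. intros; apply I_eq; simpl; unfold Rmin, Rmax; repeat destruct Rle_dec; lra. Qed.

Lemma clampI_lip (r s : R) : Rabs (val (clampI r) - val (clampI s)) <= Rabs (r - s).
Proof.
  simpl; unfold Rmin, Rmax; repeat destruct Rle_dec; unfold Rabs; repeat destruct Rcase_abs; lra.
Qed.

(** * Continuity *)

Definition rcont {M : Type} (d : M -> M -> R) (phi : M -> R) : Prop :=
  forall p eps, 0 < eps ->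
    exists del, 0 < del /\ forall q, d p q < del -> Rabs (phi p - phi q) < eps.

(** With [M] equal to [I] or [I * I] this is literally the continuity clause of [is_loop] and
    [homotopic], so the two are interchangeable by conversion. *)
Definition pcont {M X : Type} (d : M -> M -> R) (opn : (X -> Prop) -> Prop) (F : M -> X) : Prop :=
  forall U, opn U -> metric_open d (fun p => U (F p)).

Lemma near_and {M : Type} (d : M -> M -> R) (p : M) (P Q : M -> Prop) :
  (exists e, 0 < e /\ forall q, d p q < e -> P q) ->
  (exists e, 0 < e /\ forall q, d p q < e -> Q q) ->
  exists e, 0 < e /\ forall q, d p q < e -> P q /\ Q q.
Proof.
  intros [e [He H]] [f [Hf K]]. exists (Rmin e f). split.
  - apply Rmin_glb_lt; auto.
  - intros q Hq. split; [apply H | apply K]; eapply Rlt_le_trans; eauto;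
      [apply Rmin_l | apply Rmin_r].
Qed.

Lemma near_finite {M : Type} (d : M -> M -> R) (p : M) (Q : nat -> M -> Prop) (N : nat) :
  (forall k, (k < N)%nat -> exists e, 0 < e /\ forall q, d p q < e -> Q k q) ->
  exists e, 0 < e /\ forall q, d p q < e -> forall k, (k < N)%nat -> Q k q.
Proof.
  induction N as [|N IH]; intros H.
  - exists 1. split; [lra | intros; lia].
  - destruct (near_and d p (fun q => forall k, (k < N)%nat -> Q k q) (Q N)) as [e [He K]].
    + apply IH. intros; apply H; lia.
    + apply H; lia.
    + exists e. split; auto. intros q Hq k Hk. destruct (K q Hq).
      destruct (Nat.eq_dec k N); [subst; auto | apply H0; lia].
Qed.

Section RealContinuity.
Context {M : Type} {d : M -> M -> R}.

Lemma rcont_const (c : R) : rcont d (fun _ => c).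
Proof. intros p e He. exists 1. split; [lra|]. intros. rewrite Rminus_diag, Rabs_R0; auto. Qed.

Lemma rcont_lip2 (h : R -> R -> R) (phi psi : M -> R) :
  (forall a b a' b', Rabs (h a b - h a' b') <= Rabs (a - a') + Rabs (b - b')) ->
  rcont d phi -> rcont d psi -> rcont d (fun p => h (phi p) (psi p)).
Proof.
  intros Hh H K p e He.
  destruct (near_and d p _ _ (H p (e/2) ltac:(lra)) (K p (e/2) ltac:(lra))) as [f [Hf L]].
  exists f. split; auto. intros q Hq. destruct (L q Hq).
  specialize (Hh (phi p) (psi p) (phi q) (psi q)). lra.
Qed.

Lemma rcont_plus (phi psi : M -> R) :
  rcont d phi -> rcont d psi -> rcont d (fun p => phi p + psi p).
Proof.
  apply (rcont_lip2 Rplus). intros.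
  replace (a + b - (a' + b')) with ((a - a') + (b - b')) by ring. apply Rabs_triang.
Qed.

Lemma rcont_minus (phi psi : M -> R) :
  rcont d phi -> rcont d psi -> rcont d (fun p => phi p - psi p).
Proof.
  apply (rcont_lip2 Rminus). intros.
  replace (a - b - (a' - b')) with ((a - a') - (b - b')) by ring.
  unfold Rminus at 1. rewrite <- (Rabs_Ropp (b - b')). apply Rabs_triang.
Qed.

Lemma rcont_min (phi psi : M -> R) :
  rcont d phi -> rcont d psi -> rcont d (fun p => Rmin (phi p) (psi p)).
Proof.
  apply (rcont_lip2 Rmin). intros. unfold Rmin.
  repeat destruct Rle_dec; unfold Rabs; repeat destruct Rcase_abs; lra.
Qed.

Lemma rcont_max (phi psi : M -> R) :
  rcont d phi -> rcont d psi -> rcont d (fun p => Rmax (phi p) (psi p)).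
Proof.
  apply (rcont_lip2 Rmax). intros. unfold Rmax.
  repeat destruct Rle_dec; unfold Rabs; repeat destruct Rcase_abs; lra.
Qed.

Lemma rcont_comp (h : R -> R) (phi : M -> R) :
  (forall p, continuity_pt h (phi p)) -> rcont d phi -> rcont d (fun p => h (phi p)).
Proof.
  intros Hh H p e He. destruct (Hh p e He) as [a [Ha K]].
  destruct (H p a Ha) as [f [Hf L]]. exists f. split; auto. intros q Hq.
  destruct (Req_dec (phi p) (phi q)) as [E|E].
  - rewrite E, Rminus_diag, Rabs_R0; auto.
  - rewrite Rabs_minus_sym. apply (K (phi q)). split.
    + split; [exact Logic.I | exact E].
    + simpl. unfold Rdist. rewrite Rabs_minus_sym. auto.
Qed.

Lemma rcont_sqr (phi : M -> R) : rcont d phi -> rcont d (fun p => Rsqr (phi p)).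
Proof.
  intros; apply (rcont_comp Rsqr); auto. intros p. apply derivable_continuous_pt.
  apply derivable_pt_Rsqr.
Qed.

Lemma rcont_scal (c : R) (phi : M -> R) : rcont d phi -> rcont d (fun p => c * phi p).
Proof.
  intros; apply (rcont_comp (fun r => c * r)); auto. intros p.
  apply continuity_pt_scal with (f := fun r => r). apply derivable_continuous_pt, derivable_pt_id.
Qed.

Lemma rcont_ext (phi psi : M -> R) : (forall p, phi p = psi p) -> rcont d phi -> rcont d psi.
Proof. intros E H p e He. destruct (H p e He) as [f [Hf K]]. exists f. split; auto.
  intros q Hq. rewrite <- !E. auto. Qed.

Lemma rcont_mult (phi psi : M -> R) :
  rcont d phi -> rcont d psi -> rcont d (fun p => phi p * psi p).
Proof.
  intros H K.
  (* Polarization reduces products to squares. *)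
  apply rcont_ext with (phi := fun p => / 4 * (Rsqr (phi p + psi p) - Rsqr (phi p - psi p))).
  - intros; unfold Rsqr; field.
  - apply rcont_scal, rcont_minus; apply rcont_sqr; [apply rcont_plus | apply rcont_minus]; auto.
Qed.

Lemma rcont_div (phi psi : M -> R) :
  rcont d phi -> rcont d psi -> (forall p, psi p <> 0) -> rcont d (fun p => phi p / psi p).
Proof.
  intros H K N. apply rcont_mult; auto. apply (rcont_comp Rinv); auto.
  intros p. apply continuity_pt_inv with (f := fun r => r); auto. apply derivable_continuous_pt, derivable_pt_id.
Qed.

Lemma rcont_sqrt (phi : M -> R) :
  rcont d phi -> (forall p, 0 <= phi p) -> rcont d (fun p => sqrt (phi p)).
Proof. intros; apply rcont_comp; auto. intros; apply continuity_pt_sqrt; auto. Qed.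

Lemma rcont_clamp (phi : M -> R) : rcont d phi -> rcont d (fun p => val (clampI (phi p))).
Proof.
  intros; simpl. apply rcont_min; [apply rcont_const|]. apply rcont_max; [apply rcont_const|]. auto.
Qed.

Lemma near_lt (phi psi : M -> R) (p : M) :
  rcont d phi -> rcont d psi -> phi p < psi p ->
  exists e, 0 < e /\ forall q, d p q < e -> phi q < psi q.
Proof.
  intros H K L. destruct (rcont_minus _ _ K H p (psi p - phi p) ltac:(lra)) as [e [He E]].
  exists e. split; auto. intros q Hq. specialize (E q Hq). apply Rabs_def2 in E. lra.
Qed.

End RealContinuity.

Lemma rcont_val : rcont dI (fun t => val t).
Proof. intros p e He. exists e. split; auto. Qed.

Lemma rcont_fst : rcont dII (fun p => val1 p).
Proof. intros p e He. exists e. split; auto. intros q Hq. eapply Rle_lt_trans; [|exact Hq]. apply Rmax_l. Qed.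

Lemma rcont_snd : rcont dII (fun p => val2 p).
Proof. intros p e He. exists e. split; auto. intros q Hq. eapply Rle_lt_trans; [|exact Hq]. apply Rmax_r. Qed.

#[local] Hint Resolve rcont_const rcont_plus rcont_minus rcont_min rcont_max rcont_scal
  rcont_mult rcont_sqr rcont_clamp rcont_val rcont_fst rcont_snd : rc.

Section Continuity.
Context {X : Type} (opn : (X -> Prop) -> Prop).
Context {M : Type} {d : M -> M -> R}.

Lemma pcont_const (y : X) : pcont d opn (fun _ => y).
Proof. intros U _ p Hp. exists 1. split; [lra | auto]. Qed.

Lemma pcont_clamp (g : I -> X) (phi : M -> R) :
  pcont dI opn g -> rcont d phi -> pcont d opn (fun p => g (clampI (phi p))).
Proof.
  intros Hg Hp U HU p Up. destruct (Hg U HU _ Up) as [e [He K]].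
  destruct (Hp p e He) as [f [Hf L]]. exists f. split; auto. intros q Hq. apply K.
  unfold dI. eapply Rle_lt_trans; [apply clampI_lip | apply L; auto].
Qed.

Lemma pcont_clamp2 (H : I * I -> X) (phi psi : M -> R) :
  pcont dII opn H -> rcont d phi -> rcont d psi ->
  pcont d opn (fun p => H (clampI (phi p), clampI (psi p))).
Proof.
  intros Hg Hp Hs U HU p Up. destruct (Hg U HU _ Up) as [e [He K]].
  destruct (near_and d p _ _ (Hp p e He) (Hs p e He)) as [f [Hf L]].
  exists f. split; auto. intros q Hq. apply K. destruct (L q Hq).
  unfold dII, dI. apply Rmax_lub_lt; simpl fst; simpl snd;
    (eapply Rle_lt_trans; [apply clampI_lip | auto]).
Qed.

Lemma pcont_ext (F G : M -> X) : (forall p, F p = G p) -> pcont d opn F -> pcont d opn G.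
Proof.
  intros E H U HU p Hp. rewrite <- E in Hp. destruct (H U HU p Hp) as [f [Hf K]].
  exists f. split; auto. intros q Hq. rewrite <- E. apply (K q Hq).
Qed.

Lemma pcont_paste (phi : M -> R) (F G K : M -> X) :
  rcont d phi -> pcont d opn G -> pcont d opn K ->
  (forall p, phi p <= 0 -> F p = G p) -> (forall p, 0 <= phi p -> F p = K p) ->
  pcont d opn F.
Proof.
  intros Hphi HG HK EG EK U HU p Up.
  destruct (Rtotal_order (phi p) 0) as [L|[L|L]].
  - rewrite (EG p ltac:(lra)) in Up.
    destruct (near_and d p _ _ (HG U HU p Up) (near_lt _ _ p Hphi (rcont_const 0) L)) as [e [He Q]].
    exists e. split; auto. intros q Hq. destruct (Q q Hq). rewrite EG; auto; lra.
  - pose proof Up as Up'. rewrite (EG p ltac:(lra)) in Up. rewrite (EK p ltac:(lra)) in Up'.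
    destruct (near_and d p _ _ (HG U HU p Up) (HK U HU p Up')) as [e [He Q]].
    exists e. split; auto. intros q Hq. destruct (Q q Hq).
    destruct (Rle_dec (phi q) 0); [rewrite EG | rewrite EK]; auto; lra.
  - rewrite (EK p ltac:(lra)) in Up.
    destruct (near_and d p _ _ (HK U HU p Up) (near_lt _ _ p (rcont_const 0) Hphi L)) as [e [He Q]].
    exists e. split; auto. intros q Hq. destruct (Q q Hq). rewrite EK; auto; lra.
Qed.

(** Near a point of [A n] the map is [G n]. Near a point outside every [A n] the value is [x]:
    finitely many [G n] are controlled one by one, all later ones by nullness. Each [G n] is tested
    only along [A n], because a formula such as [HE_branch] makes no sense on the other circles. *)
Lemma glue_cont_local (x : X) (A : nat -> M -> Prop) (G : nat -> M -> X) (F : M -> X) :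
  (forall n p, A n p -> exists e, 0 < e /\ forall q, d p q < e -> A n q) ->
  (forall n p, A n p -> F p = G n p) ->
  (forall p, (forall n, ~ A n p) -> F p = x) ->
  (forall n U p, opn U -> U (F p) -> (A n p \/ forall m, ~ A m p) ->
     exists e, 0 < e /\ forall q, d p q < e -> A n q -> U (G n q)) ->
  (forall U, opn U -> U x -> exists N, forall n, (N <= n)%nat -> forall p, A n p -> U (G n p)) ->
  pcont d opn F.
Proof.
  intros HA HF Hx HG Hnull U HU p Up.
  destruct (excluded_middle_informative (exists n, A n p)) as [[n An]|N].
  - destruct (near_and d p _ _ (HA n p An) (HG n U p HU Up (or_introl An))) as [e [He Q]].
    exists e. split; auto. intros q Hq. destruct (Q q Hq). rewrite (HF n); auto.
  - assert (N' : forall n, ~ A n p) by (intros n An; apply N; eauto).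
    destruct (Hnull U HU) as [m Hm]. { rewrite <- (Hx p N'); auto. }
    destruct (near_finite d p (fun n q => A n q -> U (G n q)) m) as [e [He Q]].
    { intros; apply HG; auto. }
    exists e. split; auto. intros q Hq.
    destruct (excluded_middle_informative (exists n, A n q)) as [[n An]|N2].
    + rewrite (HF n); auto. destruct (Nat.le_gt_cases m n); [apply Hm | apply Q]; auto.
    + rewrite (Hx q), <- (Hx p); auto. intros n An; apply N2; eauto.
Qed.

Lemma glue_cont (x : X) (A : nat -> M -> Prop) (G : nat -> M -> X) (F : M -> X) :
  (forall n p, A n p -> exists e, 0 < e /\ forall q, d p q < e -> A n q) ->
  (forall n p, A n p -> F p = G n p) ->
  (forall p, (forall n, ~ A n p) -> F p = x) ->
  (forall n p, ~ A n p -> G n p = x) ->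
  (forall n, pcont d opn (G n)) ->
  (forall U, opn U -> U x -> exists N, forall n, (N <= n)%nat -> forall p, U (G n p)) ->
  pcont d opn F.
Proof.
  intros HA HF Hx HGx HG Hnull. apply (glue_cont_local x A G F); auto.
  - intros n U p HU Up Ap. destruct (HG n U HU p) as [e [He K]].
    + destruct Ap as [An|N]; [rewrite <- HF; auto | rewrite HGx, <- (Hx p N); auto].
    + exists e; split; auto.
  - intros U HU Ux. destruct (Hnull U HU Ux) as [N HN]. exists N. auto.
Qed.

End Continuity.

(** * Homotopy of loops inside a subset *)

Lemma rcont_comp_fst (phi : I -> R) : rcont dI phi -> rcont dII (fun p => phi (fst p)).
Proof.
  intros H p e He. destruct (H (fst p) e He) as [f [Hf K]]. exists f. split; auto.
  intros q Hq. apply K. eapply Rle_lt_trans; [|exact Hq]. apply Rmax_l.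
Qed.

Lemma rcont_comp_snd (phi : I -> R) : rcont dI phi -> rcont dII (fun p => phi (snd p)).
Proof.
  intros H p e He. destruct (H (snd p) e He) as [f [Hf K]]. exists f. split; auto.
  intros q Hq. apply K. eapply Rle_lt_trans; [|exact Hq]. apply Rmax_r.
Qed.

#[local] Hint Resolve rcont_comp_fst rcont_comp_snd : rc.

Definition rev {Y : Type} (g : I -> Y) : I -> Y := fun t => g (clampI (1 - val t)).

Section PathAlgebra.
Context {X : Type} (opn : (X -> Prop) -> Prop) (S : X -> Prop) (x : X).

Local Notation loop g := (is_loop opn S x g).
Local Notation "g =~ h" := (homotopic opn S x g h) (at level 70).

Lemma homotopic_loop_l (g h : I -> X) : g =~ h -> loop g.
Proof.
  intros [H [HS [Hc [H0 [H1 He]]]]]. split; [|split; [|split]].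
  - intros t. rewrite <- H0. auto.
  - apply (pcont_ext opn (fun t : I => H (clampI (val t), clampI 0))).
    + intros t. rewrite clampI_val, (clampI_le0 0) by lra. auto.
    + apply pcont_clamp2; auto 10 with rc.
  - rewrite <- H0. apply He.
  - rewrite <- H0. apply He.
Qed.

Lemma homotopic_sym (g h : I -> X) : g =~ h -> h =~ g.
Proof.
  intros [H [HS [Hc [H0 [H1 He]]]]].
  exists (fun p : I * I => H (fst p, clampI (1 - val2 p))). split; [|split; [|split; [|split]]]; auto.
  - apply (pcont_ext opn (fun p : I * I => H (clampI (val1 p), clampI (1 - val2 p)))).
    + intros. rewrite clampI_val. auto.
    + apply pcont_clamp2; auto 10 with rc.
  - intros. simpl fst; simpl snd. rewrite clampI_ge1; simpl; auto; lra.
  - intros. simpl fst; simpl snd. rewrite clampI_le0; simpl; auto; lra.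
Qed.

Lemma homotopic_trans (g h k : I -> X) : g =~ h -> h =~ k -> g =~ k.
Proof.
  intros [H [HS [Hc [H0 [H1 He]]]]] [K [KS [Kc [K0 [K1 Ke]]]]].
  exists (fun p => if Rle_dec (val2 p) (1/2) then H (fst p, clampI (2 * val2 p))
                   else K (fst p, clampI (2 * val2 p - 1))).
  split; [|split; [|split; [|split]]].
  - intros p. destruct Rle_dec; auto.
  - apply (pcont_paste opn (fun p : I * I => val2 p - 1/2) _
       (fun p : I * I => H (clampI (val1 p), clampI (2 * val2 p)))
       (fun p : I * I => K (clampI (val1 p), clampI (2 * val2 p - 1)))).
    + auto 10 with rc.
    + apply pcont_clamp2; auto 10 with rc.
    + apply pcont_clamp2; auto 10 with rc.
    + intros p Hp. rewrite clampI_val. destruct Rle_dec; auto; exfalso; lra.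
    + intros p Hp. rewrite clampI_val. destruct Rle_dec; auto.
      rewrite (clampI_ge1 (2 * _)), (clampI_le0 (2 * _ - 1)), H1, K0 by lra. auto.
  - intros s. simpl fst; simpl snd. destruct Rle_dec as [r|r]; simpl in r; [|exfalso; lra].
    rewrite clampI_le0; simpl; auto; lra.
  - intros s. simpl fst; simpl snd. destruct Rle_dec as [r|r]; simpl in r; [exfalso; lra|].
    rewrite clampI_ge1; simpl; auto; lra.
  - intros t. simpl fst; simpl snd. destruct Rle_dec; auto.
Qed.

Lemma homotopic_loop_r (g h : I -> X) : g =~ h -> loop h.
Proof. intros H. apply homotopic_sym in H. eapply homotopic_loop_l; eauto. Qed.

(** The parameters are joined by straight lines. The homotopy takes only values of [g], hence stays
    in [S]. *)
Lemma homotopic_reparam (g : I -> X) (th0 th1 : I -> R) :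
  pcont dI opn g -> (forall t, S (g t)) -> rcont dI th0 -> rcont dI th1 ->
  th0 I0 = th1 I0 -> th0 I1 = th1 I1 ->
  g (clampI (th0 I0)) = x -> g (clampI (th0 I1)) = x ->
  (fun t => g (clampI (th0 t))) =~ (fun t => g (clampI (th1 t))).
Proof.
  intros Hg HS C0 C1 E0 E1 X0 X1.
  exists (fun p => g (clampI ((1 - val2 p) * th0 (fst p) + val2 p * th1 (fst p)))).
  split; [|split; [|split; [|split]]]; auto.
  - apply pcont_clamp; auto 10 with rc.
  - intros s. simpl. f_equal. f_equal. ring.
  - intros s. simpl. f_equal. f_equal. ring.
  - intros t. simpl fst; simpl snd. rewrite <- E0, <- E1. split.
    + rewrite <- X0. f_equal. f_equal. ring.
    + rewrite <- X1. f_equal. f_equal. ring.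
Qed.

Lemma reparam_id (g h : I -> X) (th : I -> R) :
  loop g -> rcont dI th -> th I0 = 0 -> th I1 = 1 ->
  (forall t, h t = g (clampI (th t))) -> g =~ h.
Proof.
  intros [HS [Hc [H0 H1]]] Ht E0 E1 E.
  replace h with (fun t => g (clampI (th t))) by (extensionality t; auto).
  replace g with (fun t : I => g (clampI (val t))) at 1 by (extensionality t; rewrite clampI_val; auto).
  apply homotopic_reparam; auto 10 with rc; simpl.
  - rewrite clampI_le0; auto; lra.
  - rewrite clampI_ge1; auto; lra.
Qed.

Lemma homotopic_refl (g : I -> X) : loop g -> g =~ g.
Proof.
  intros H. apply (reparam_id g g (fun t : I => val t)); auto 10 with rc.
  intros; rewrite clampI_val; auto.
Qed.

Lemma loop_const : S x -> loop (fun _ => x).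
Proof. intros. split; [|split]; auto. apply (pcont_const opn). Qed.

Lemma homotopic_concat (g g' h h' : I -> X) : g =~ g' -> h =~ h' -> concat g h =~ concat g' h'.
Proof.
  intros [H [HS [Hc [H0 [H1 He]]]]] [K [KS [Kc [K0 [K1 Ke]]]]].
  exists (fun p => if Rle_dec (val1 p) (1/2) then H (clampI (2 * val1 p), snd p)
                   else K (clampI (2 * val1 p - 1), snd p)).
  split; [|split; [|split; [|split]]].
  - intros p. destruct Rle_dec; auto.
  - apply (pcont_paste opn (fun p : I * I => val1 p - 1/2) _
       (fun p : I * I => H (clampI (2 * val1 p), clampI (val2 p)))
       (fun p : I * I => K (clampI (2 * val1 p - 1), clampI (val2 p)))).
    + auto 10 with rc.
    + apply pcont_clamp2; auto 10 with rc.
    + apply pcont_clamp2; auto 10 with rc.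
    + intros p Hp. rewrite clampI_val. destruct Rle_dec; auto; exfalso; lra.
    + intros p Hp. rewrite clampI_val. destruct Rle_dec; auto.
      rewrite (clampI_ge1 (2 * _)), (clampI_le0 (2 * _ - 1)) by lra.
      destruct (He (snd p)) as [_ ->], (Ke (snd p)) as [-> _]. auto.
  - intros s. unfold concat. simpl fst; simpl snd. destruct Rle_dec; auto.
  - intros s. unfold concat. simpl fst; simpl snd. destruct Rle_dec; auto.
  - intros t. simpl fst; simpl snd. split; destruct Rle_dec as [r|r]; simpl in r; try (exfalso; lra).
    + rewrite clampI_le0 by (simpl; lra). apply He.
    + rewrite clampI_ge1 by (simpl; lra). apply Ke.
Qed.

Lemma loop_concat (g h : I -> X) : loop g -> loop h -> loop (concat g h).
Proof.
  intros. apply (homotopic_loop_l _ (concat g h)). apply homotopic_concat; apply homotopic_refl; auto.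
Qed.

Lemma loop_rev (g : I -> X) : loop g -> loop (rev g).
Proof.
  intros [HS [Hc [H0 H1]]]. split; [|split; [|split]]; unfold rev; auto.
  - apply (pcont_clamp opn g); auto 10 with rc.
  - rewrite clampI_ge1; simpl; auto; lra.
  - rewrite clampI_le0; simpl; auto; lra.
Qed.

Lemma concat_1r (g : I -> X) : loop g -> concat g (fun _ => x) =~ g.
Proof.
  intros H. apply homotopic_sym, (reparam_id _ _ (fun t : I => Rmin 1 (2 * val t))); auto 10 with rc.
  - simpl. minmax.
  - simpl. minmax.
  - destruct H as [HS [Hc [H0 H1]]]. intros t. unfold concat. destruct Rle_dec.
    + f_equal. f_equal. minmax.
    + rewrite clampI_ge1; auto. minmax.
Qed.

(** The concatenation is [g] along a parameter that runs from 1 to 0 and back, that is, along the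
    absolute value of [2 t - 1]; this parameter contracts to the constant 1. *)
Lemma concat_revl (g : I -> X) : loop g -> concat (rev g) g =~ (fun _ => x).
Proof.
  intros H. pose proof H as [HS [Hc [H0 H1]]].
  replace (concat (rev g) g) with (fun t : I => g (clampI (Rmax (1 - 2 * val t) (2 * val t - 1)))).
  - replace (fun _ : I => x) with (fun t : I => g (clampI 1))
      by (extensionality t; rewrite clampI_ge1; auto; lra).
    apply (homotopic_reparam g (fun t : I => Rmax (1 - 2 * val t) (2 * val t - 1)) (fun _ => 1)); auto 10 with rc; simpl;
     try rewrite clampI_ge1; auto; minmax.
  - extensionality t. pose proof (I_bounds t). unfold concat, rev, Rmax. destruct (Rle_dec (val t)), Rle_dec;
     try rewrite val_clampI by lra; try (f_equal; f_equal; lra).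
Qed.

Lemma concat_revr (g : I -> X) : loop g -> concat g (rev g) =~ (fun _ => x).
Proof.
  intros H. pose proof H as [HS [Hc [H0 H1]]].
  replace (concat g (rev g)) with (fun t : I => g (clampI (Rmin (2 * val t) (2 - 2 * val t)))).
  - replace (fun _ : I => x) with (fun t : I => g (clampI 0))
      by (extensionality t; rewrite clampI_le0; auto; lra).
    apply (homotopic_reparam g (fun t : I => Rmin (2 * val t) (2 - 2 * val t)) (fun _ => 0)); auto 10 with rc; simpl;
     try rewrite clampI_le0; auto; minmax.
  - extensionality t. pose proof (I_bounds t). unfold concat, rev, Rmin. destruct (Rle_dec (val t)), Rle_dec;
     try rewrite val_clampI by lra; try (f_equal; f_equal; lra).
Qed.

Lemma concat_assoc (f g h : I -> X) : loop f -> loop g -> loop h ->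
  concat f (concat g h) =~ concat (concat f g) h.
Proof.
  intros Hf Hg Hh.
  (* The break points 1/4, 1/2 must go to 1/2, 3/4. The piecewise linear map doing so has slopes 2,
     1, 1/2; it is concave, hence the minimum of its three lines. *)
  apply (reparam_id _ _ (fun t : I => Rmin (2 * val t) (Rmin (val t + 1/4) ((val t + 1) * /2))));
    auto 10 using loop_concat with rc.
  - simpl. minmax.
  - simpl. minmax.
  - intros t. pose proof (I_bounds t).
    destruct Hf as [_ [_ [F0 F1]]], Hg as [_ [_ [G0 G1]]], Hh as [_ [_ [K0 K1]]].
    assert (B : 0 <= Rmin (2 * val t) (Rmin (val t + 1/4) ((val t + 1) * /2)) <= 1)
     by (minmax).
    unfold concat. rewrite (val_clampI _ B).
    destruct (Rle_dec (val t) (1/2)) as [a|a].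
    + rewrite (val_clampI (2 * val t)) by lra.
      destruct (Rle_dec (2 * val t) (1/2)) as [b|b].
      * replace (Rmin (2 * val t) _) with (2 * val t) by (minmax).
        destruct Rle_dec; [auto|exfalso; lra].
      * replace (Rmin (2 * val t) _) with (val t + 1/4) by (minmax).
        destruct Rle_dec; [exfalso; lra|]. rewrite val_clampI by lra. destruct Rle_dec; [|exfalso; lra].
        f_equal. f_equal. lra.
    + replace (Rmin (2 * val t) _) with ((val t + 1) * /2) by (minmax).
      destruct Rle_dec; [exfalso; lra|]. rewrite val_clampI by lra. destruct Rle_dec; [exfalso; lra|].
      f_equal. f_equal. lra.
Qed.

Lemma concat_split (P : I -> X) (a : R) : loop P -> 0 <= a <= 1 -> P (clampI a) = x ->
  P =~ concat (fun t : I => P (clampI (Rmin (val t) a))) (fun t : I => P (clampI (Rmax (val t) a))).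
Proof.
  intros H Ha Pa.
  (* On the left half the second summand is [a], which leaves [Rmin (2 t) a]; on the right half the
     first one is [a], which leaves [Rmax (2 t - 1) a]. *)
  apply (reparam_id _ _ (fun t : I => Rmin (Rmin (2 * val t) 1) a + Rmax (Rmax (2 * val t - 1) 0) a - a));
    auto 10 with rc.
  - simpl. minmax.
  - simpl. minmax.
  - intros t. pose proof (I_bounds t). unfold concat. destruct Rle_dec.
    + rewrite val_clampI by lra. f_equal. f_equal. minmax.
    + rewrite val_clampI by lra. f_equal. f_equal. minmax.
Qed.

Lemma loop_restrict_l (P : I -> X) (a : R) : loop P -> 0 <= a <= 1 -> P (clampI a) = x ->
  loop (fun t : I => P (clampI (Rmin (val t) a))).
Proof.
  intros [HS [Hc [H0 H1]]] Ha Pa. split; [|split; [|split]]; auto.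
  - apply (pcont_clamp opn P); auto 10 with rc.
  - rewrite Rmin_left, clampI_le0 by (simpl; lra). auto.
  - rewrite Rmin_right by (simpl; lra). auto.
Qed.

Lemma loop_restrict_r (P : I -> X) (a : R) : loop P -> 0 <= a <= 1 -> P (clampI a) = x ->
  loop (fun t : I => P (clampI (Rmax (val t) a))).
Proof.
  intros [HS [Hc [H0 H1]]] Ha Pa. split; [|split; [|split]]; auto.
  - apply (pcont_clamp opn P); auto 10 with rc.
  - rewrite Rmax_right by (simpl; lra). auto.
  - rewrite Rmax_left, clampI_ge1 by (simpl; lra). auto.
Qed.

Lemma concat_rev_cancel_r (g h : I -> X) : loop g -> loop h -> concat (concat g (rev h)) h =~ g.
Proof.
  intros Hg Hh. pose proof (loop_rev h Hh).
  eapply homotopic_trans; [apply homotopic_sym, concat_assoc; auto|].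
  eapply homotopic_trans; [|apply concat_1r; auto].
  apply homotopic_concat; [apply homotopic_refl | apply concat_revl]; auto.
Qed.

Lemma concat_cancel_rev_r (g h : I -> X) : loop g -> loop h -> concat (concat g h) (rev h) =~ g.
Proof.
  intros Hg Hh. pose proof (loop_rev h Hh).
  eapply homotopic_trans; [apply homotopic_sym, concat_assoc; auto|].
  eapply homotopic_trans; [|apply concat_1r; auto].
  apply homotopic_concat; [apply homotopic_refl | apply concat_revr]; auto.
Qed.

(* (L F R) (L R)^-1 = L F L^-1 *)
Lemma conjugate_quotient (L F R P P' : I -> X) : loop L -> loop F -> loop R ->
  P =~ concat L (concat F R) -> P' =~ concat L R ->
  concat L (concat F (rev L)) =~ concat P (rev P').
Proof.
  intros HL HF HR HP HP'.
  pose proof (loop_rev _ HL) as HrL. pose proof (loop_concat _ _ HF HrL) as HFL.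
  pose proof (homotopic_loop_l _ _ HP') as LP'.
  pose proof (loop_concat _ _ HL HFL) as HLFL.
  eapply homotopic_trans; [apply homotopic_sym, (concat_cancel_rev_r _ P'); auto|].
  apply homotopic_concat; [|apply homotopic_refl, loop_rev; auto].
  eapply homotopic_trans; [|apply homotopic_sym; exact HP].
  eapply homotopic_trans; [apply homotopic_concat; [apply homotopic_refl; auto|exact HP']|].
  eapply homotopic_trans; [apply homotopic_sym, concat_assoc; auto using loop_concat|].
  apply homotopic_concat; [apply homotopic_refl; auto|].
  eapply homotopic_trans; [apply concat_assoc; auto using loop_concat|].
  apply homotopic_concat; [|apply homotopic_refl; auto].
  apply concat_rev_cancel_r; auto.
Qed.

End PathAlgebra.

Lemma is_loop_subset {X : Type} (opn : (X -> Prop) -> Prop) (S S' : X -> Prop) (x : X) (g : I -> X) :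
  (forall t, S' (g t)) -> is_loop opn S x g -> is_loop opn S' x g.
Proof. intros HS [_ H]. split; auto. Qed.

(** * Infinite products along families of intervals *)

Definition mix (u v s : R) : R := (1 - s) * u + s * v.

Lemma mix_le (u v u' v' s : R) : 0 <= s <= 1 -> u <= u' -> v <= v' -> mix u v s <= mix u' v' s.
Proof. intros; unfold mix; nra. Qed.

Lemma mix_lt (u v u' v' s : R) : 0 <= s <= 1 -> u < u' -> v < v' -> mix u v s < mix u' v' s.
Proof.
  intros. unfold mix. destruct (Req_dec s 0) as [->|]; [lra|].
  assert (s * v < s * v') by (apply Rmult_lt_compat_l; lra).
  assert ((1 - s) * u <= (1 - s) * u') by (apply Rmult_le_compat_l; lra). lra.
Qed.

Lemma rcont_mix (u v : R) : rcont dII (fun p => mix u v (val2 p)).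
Proof. unfold mix. auto 10 with rc. Qed.

Definition ramp (a b t : R) : R := (t - a) / (b - a).

Lemma ramp_le0 (a b t : R) : a < b -> t <= a -> ramp a b t <= 0.
Proof.
  intros. unfold ramp. apply Rmult_le_reg_r with (b - a); [lra|].
  unfold Rdiv. rewrite Rmult_assoc, Rinv_l by lra. lra.
Qed.

Lemma ramp_ge1 (a b t : R) : a < b -> b <= t -> 1 <= ramp a b t.
Proof.
  intros. unfold ramp. apply Rmult_le_reg_r with (b - a); [lra|].
  unfold Rdiv. rewrite Rmult_assoc, Rinv_l by lra. lra.
Qed.

Lemma ramp_bounds (a b t : R) : a < b -> a <= t <= b -> 0 <= ramp a b t <= 1.
Proof.
  intros. unfold ramp.
  split; apply Rmult_le_reg_r with (b - a); try lra;
  unfold Rdiv; rewrite Rmult_assoc, Rinv_l by lra; lra.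
Qed.

Lemma ramp_inside (a b t : R) : a < b -> a < t < b -> 0 < ramp a b t < 1.
Proof.
  intros. unfold ramp.
  split; apply Rmult_lt_reg_r with (b - a); try lra;
  unfold Rdiv; rewrite Rmult_assoc, Rinv_l by lra; lra.
Qed.

Lemma ramp_mix (a b t : R) : a < b -> mix a b (ramp a b t) = t.
Proof. intros. unfold mix, ramp. field. lra. Qed.

Lemma rcont_ramp (a b : R) : a < b -> rcont dI (fun t : I => ramp a b (val t)).
Proof. intros. unfold ramp. apply rcont_div; auto 10 with rc. intros; lra. Qed.

Definition within (a b : nat -> R) : Prop := forall n, 0 <= a n /\ a n < b n /\ b n <= 1.

Definition same_order (a b a' b' : nat -> R) : Prop :=
  forall i j, i <> j -> (b i <= a j /\ b' i <= a' j) \/ (b j <= a i /\ b' j <= a' i).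

Definition separated (a b : nat -> R) : Prop :=
  forall i j, i <> j -> b i <= a j \/ b j <= a i.

Definition consecutive (a b : nat -> R) : Prop := forall i j, (i < j)%nat -> b i <= a j.

Lemma consecutive_same_order (a b a' b' : nat -> R) :
  consecutive a b -> consecutive a' b' -> same_order a b a' b'.
Proof. intros H H' i j N. destruct (Nat.lt_gt_cases i j) as [K _]. destruct (K N); [left | right]; auto. Qed.

Lemma consecutive_separated (a b : nat -> R) : consecutive a b -> separated a b.
Proof. intros H i j N. destruct (Nat.lt_gt_cases i j) as [K _]. destruct (K N); [left | right]; auto. Qed.

Section Placed.
Context {X : Type} (opn : (X -> Prop) -> Prop) (x : X).

Local Notation all := (fun _ : X => True).
Local Notation "g =~ h" := (homotopic opn all x g h) (at level 70).

Definition null_fam {M : Type} (G : nat -> M -> X) : Prop :=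
  forall U, opn U -> U x -> exists N, forall n, (N <= n)%nat -> forall p, U (G n p).

(** Bounds the room in which the n-th of infinitely many simultaneous homotopies may move. *)
Definition null_sets (S : nat -> X -> Prop) : Prop :=
  forall U, opn U -> U x -> exists N, forall n, (N <= n)%nat -> forall y, S n y -> U y.

(** Open intervals are used so that the half-open pieces of [prod_inf] and the closed pieces of
    [prod_tau] both fit. *)
Definition placed (alpha : nat -> I -> X) (a b : nat -> R) (P : I -> X) : Prop :=
  (forall n t, a n < val t < b n -> P t = alpha n (clampI (ramp (a n) (b n) (val t)))) /\
  (forall t, (forall n, ~ (a n < val t < b n)) -> P t = x).

(** The endpoints of all intervals move linearly at the same time while [H n] runs inside the n-th
    one. The common order keeps the intervals disjoint at every moment, and nullness of the [H n]
    gives continuity where intervals accumulate. *)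
Lemma homotopic_placed (H : nat -> I * I -> X) (a b a' b' : nat -> R) (P P' : I -> X) :
  within a b -> within a' b' -> same_order a b a' b' ->
  (forall n, pcont dII opn (H n)) -> (forall n s, H n (I0, s) = x /\ H n (I1, s) = x) ->
  null_fam H ->
  placed (fun n t => H n (t, I0)) a b P -> placed (fun n t => H n (t, I1)) a' b' P' ->
  P =~ P'.
Proof.
  intros W W' O Hc He Hn [P1 P2] [P1' P2'].
  set (A := fun (n : nat) (p : I * I) =>
    mix (a n) (a' n) (val2 p) < val1 p < mix (b n) (b' n) (val2 p)).
  set (G := fun (n : nat) (p : I * I) =>
    H n (clampI (ramp (mix (a n) (a' n) (val2 p)) (mix (b n) (b' n) (val2 p)) (val1 p)), snd p)).
  set (K := fun p : I * I => match excluded_middle_informative (exists n, A n p) with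
    | left h => G (proj1_sig (constructive_indefinite_description _ h)) p
    | right _ => x end).
  assert (Auniq : forall n m p, A n p -> A m p -> n = m).
  { intros n m p An Am. destruct (Nat.eq_dec n m) as [|N]; auto. exfalso.
    unfold A in *. pose proof (I_bounds (snd p)).
    destruct (O n m N) as [[]|[]].
    - pose proof (mix_le (b n) (b' n) (a m) (a' m) (val2 p)). lra.
    - pose proof (mix_le (b m) (b' m) (a n) (a' n) (val2 p)). lra. }
  assert (KA : forall n p, A n p -> K p = G n p).
  { intros n p An. unfold K. destruct excluded_middle_informative as [h|h].
    - rewrite (Auniq _ n p (proj2_sig (constructive_indefinite_description _ h)) An). auto.
    - exfalso; eauto. }
  assert (KN : forall p, (forall n, ~ A n p) -> K p = x).
  { intros p N. unfold K. destruct excluded_middle_informative as [[n h]|h]; auto. exfalso; eapply N; eauto. }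
  assert (Mlt : forall n p, mix (a n) (a' n) (val2 p) < mix (b n) (b' n) (val2 p)).
  { intros n p. apply mix_lt; [apply I_bounds | apply W | apply W']. }
  exists K. split; [|split; [|split; [|split]]]; auto.
  - apply (glue_cont opn x A G K); auto.
    + intros n p [A1 A2]. apply near_and; apply near_lt; auto using rcont_mix with rc.
    + intros n p NA. unfold G.
      destruct (Rle_dec (val1 p) (mix (a n) (a' n) (val2 p))) as [r|r].
      * rewrite clampI_le0 by (apply ramp_le0; auto). apply He.
      * rewrite clampI_ge1. { apply He. } apply ramp_ge1; auto.
        apply Rnot_lt_le. intros L. apply NA. unfold A. lra.
    + intros n. unfold G.
      apply (pcont_ext opn (fun p => H n (clampI (ramp (mix (a n) (a' n) (val2 p))
          (mix (b n) (b' n) (val2 p)) (val1 p)), clampI (val2 p)))).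
      * intros. rewrite clampI_val. auto.
      * apply pcont_clamp2; auto with rc. unfold ramp.
        apply rcont_div; auto using rcont_mix with rc.
        intros p. specialize (Mlt n p). lra.
    + intros U HU Ux. destruct (Hn U HU Ux) as [N HN]. exists N. intros; apply HN; auto.
  - intros s. assert (E : forall n, A n (s, I0) <-> a n < val s < b n).
    { intros n. unfold A, mix; simpl. split; intros; lra. }
    destruct (excluded_middle_informative (exists n, A n (s, I0))) as [[n h]|h].
    + rewrite (KA n), (P1 n) by (auto; apply E; auto). unfold G. simpl. f_equal. f_equal. f_equal.
      unfold ramp, mix. f_equal; ring.
    + rewrite KN, P2; auto; intros n K'; apply h; exists n; auto; apply E; auto.
  - intros s. assert (E : forall n, A n (s, I1) <-> a' n < val s < b' n).
    { intros n. unfold A, mix; simpl. split; intros; lra. }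
    destruct (excluded_middle_informative (exists n, A n (s, I1))) as [[n h]|h].
    + rewrite (KA n), (P1' n) by (auto; apply E; auto). unfold G. simpl. f_equal. f_equal. f_equal.
      unfold ramp, mix. f_equal; ring.
    + rewrite KN, P2'; auto; intros n K'; apply h; exists n; auto; apply E; auto.
  - intros t. split; apply KN; intros n [A1 A2]; simpl in A1, A2; pose proof (I_bounds t);
      specialize (W n); specialize (W' n).
    + pose proof (mix_le 0 0 (a n) (a' n) (val t)). unfold mix in *. lra.
    + pose proof (mix_le (b n) (b' n) 1 1 (val t)). unfold mix in *. lra.
Qed.

Lemma homotopic_placed_reorder (alpha : nat -> I -> X) (a b a' b' : nat -> R) (P P' : I -> X) :
  within a b -> within a' b' -> same_order a b a' b' -> null_seq opn x alpha ->
  placed alpha a b P -> placed alpha a' b' P' -> P =~ P'.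
Proof.
  intros W W' O [HL Hn] HP HP'.
  apply (homotopic_placed (fun n p => alpha n (fst p)) a b a' b'); auto.
  - intros n. apply (pcont_ext opn (fun p => alpha n (clampI (val1 p)))).
    + intros; rewrite clampI_val; auto.
    + apply pcont_clamp; auto with rc. exact (proj1 (proj2 (HL n))).
  - intros n s. destruct (HL n) as [_ [_ [E0 E1]]]. auto.
  - intros U HU Ux. destruct (Hn U HU Ux) as [N HN]. exists N. intros; apply HN; auto.
Qed.

Lemma same_order_refl (a b : nat -> R) : separated a b -> same_order a b a b.
Proof. intros H i j N. destruct (H i j N); auto. Qed.

(** A placed product is homotopic to itself by [homotopic_placed], and the source of a homotopy is a
    loop; no separate continuity argument is made. *)
Lemma loop_placed (alpha : nat -> I -> X) (a b : nat -> R) (P : I -> X) :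
  within a b -> separated a b -> null_seq opn x alpha -> placed alpha a b P ->
  is_loop opn all x P.
Proof.
  intros. apply (homotopic_loop_l opn all x P P).
  apply (homotopic_placed_reorder alpha a b a b); auto using same_order_refl.
Qed.

(** An endpoint lies in no open interval of a separated family, so both sides are [x] there. *)
Lemma placed_closed (alpha : nat -> I -> X) (a b : nat -> R) (P : I -> X) :
  within a b -> separated a b -> (forall n, alpha n I0 = x /\ alpha n I1 = x) ->
  placed alpha a b P ->
  forall n t, a n <= val t <= b n -> P t = alpha n (clampI (ramp (a n) (b n) (val t))).
Proof.
  intros W O He [P1 P2] n t Ht.
  destruct (Req_dec (a n) (val t)) as [E|E]; [|destruct (Req_dec (b n) (val t)) as [E'|E']].
  - rewrite clampI_le0. 2:{ apply ramp_le0; [apply W|lra]. }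
    rewrite P2; [symmetry; apply He|]. intros m K. pose proof (W n).
    destruct (Nat.eq_dec n m); [subst; lra|]. destruct (O n m n0); lra.
  - rewrite clampI_ge1. 2:{ apply ramp_ge1; [apply W|lra]. }
    rewrite P2; [symmetry; apply He|]. intros m K. pose proof (W n).
    destruct (Nat.eq_dec n m); [subst; lra|]. destruct (O n m n0); lra.
  - apply P1. lra.
Qed.

(** * The product of order type omega *)

Definition el (n : nat) : R := INR n / (INR n + 1).

Lemma el_alt (n : nat) : el n = 1 - / (INR n + 1).
Proof. unfold el. pose proof (pos_INR n). field. lra. Qed.

Lemma el_mono (m n : nat) : (m <= n)%nat -> el m <= el n.
Proof.
  intros H. rewrite !el_alt. apply le_INR in H. pose proof (pos_INR m).
  assert (/ (INR n + 1) <= / (INR m + 1)) by (apply Rinv_le_contravar; lra). lra.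
Qed.

Lemma el_lt (n : nat) : el n < el (S n).
Proof.
  rewrite !el_alt, S_INR. pose proof (pos_INR n).
  assert (/ (INR n + 1 + 1) < / (INR n + 1)) by (apply Rinv_lt_contravar; [nra|lra]). lra.
Qed.

Lemma el_bounds (n : nat) : 0 <= el n < 1.
Proof.
  rewrite el_alt. pose proof (pos_INR n).
  assert (0 < / (INR n + 1)) by (apply Rinv_0_lt_compat; lra).
  assert (/ (INR n + 1) <= / 1) by (apply Rinv_le_contravar; lra). lra.
Qed.

Lemma el_within : within el (fun n => el (S n)).
Proof. intros n. pose proof (el_bounds n). pose proof (el_bounds (S n)). pose proof (el_lt n). lra. Qed.

Lemma el_consecutive : consecutive el (fun n => el (S n)).
Proof. intros i j H. apply el_mono. lia. Qed.

#[local] Hint Resolve el_within el_consecutive consecutive_separated consecutive_same_order : el.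

Lemma piece_inf_S (t : R) (n : nat) : piece_inf t (S n) <-> el n <= t < el (S n).
Proof.
  unfold piece_inf, el. rewrite !S_INR. replace (INR n + 1 - 1) with (INR n) by ring.
  split; [intros [_ H]; auto | split; [lia|auto]].
Qed.

Lemma el_index_unique (n m : nat) (t : R) : el n <= t < el (S n) -> el m <= t < el (S m) -> n = m.
Proof.
  intros H K. destruct (Nat.lt_trichotomy n m) as [L|[L|L]]; auto; exfalso.
  - pose proof (el_mono (S n) m L). lra.
  - pose proof (el_mono (S m) n L). lra.
Qed.

Lemma prod_inf_placed (alpha : nat -> I -> X) : (forall n, alpha n I0 = x) ->
  placed alpha el (fun n => el (S n)) (prod_inf x alpha).
Proof.
  intros H0.
  assert (V : forall n t, el n <= val t < el (S n) ->
    prod_inf x alpha t = alpha n (clampI (ramp (el n) (el (S n)) (val t)))).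
  { intros n t Ht. unfold prod_inf. destruct excluded_middle_informative as [h|h].
    - destruct constructive_indefinite_description as [m Hm]. simpl.
      destruct m as [|m]; [destruct Hm; lia|].
      pose proof Hm as Hm'. apply piece_inf_S in Hm'. rewrite (el_index_unique n m _ Ht Hm').
      replace (S m - 1)%nat with m by lia. unfold ramp, el. rewrite !S_INR.
      replace (INR m + 1 - 1) with (INR m) by ring. auto.
    - exfalso. apply h. exists (S n). apply piece_inf_S. auto. }
  split.
  - intros; apply V; lra.
  - intros t N. destruct (excluded_middle_informative (exists n, piece_inf (val t) n)) as [[n h]|h].
    + destruct n as [|n]; [destruct h; lia|]. apply piece_inf_S in h. rewrite (V n); auto.
      (* A point of the half-open piece outside its interior is the left endpoint; the right
         endpoint belongs to the next piece. *)
      specialize (N n). rewrite clampI_le0; auto. apply ramp_le0; [apply el_lt|lra].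
    + unfold prod_inf. destruct excluded_middle_informative; [contradiction|auto].
Qed.

Lemma prod_inf_loop (alpha : nat -> I -> X) : null_seq opn x alpha ->
  is_loop opn all x (prod_inf x alpha).
Proof.
  intros H. apply (loop_placed alpha el (fun n => el (S n))); auto with el.
  apply prod_inf_placed. intros; apply H.
Qed.

(** All factors are deformed at once on fixed intervals; the shrinking sets [S n] turn the chosen
    homotopies into a null family. *)
Lemma prod_inf_small_homotopy (S : nat -> X -> Prop) (beta beta' : nat -> I -> X) :
  null_sets S -> (forall n, homotopic opn (S n) x (beta n) (beta' n)) ->
  prod_inf x beta =~ prod_inf x beta'.
Proof.
  intros HS H.
  set (K := fun n => proj1_sig (constructive_indefinite_description _ (H n))).
  assert (HK : forall n, (forall p, S n (K n p)) /\ pcont dII opn (K n) /\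
    (forall s, K n (s, I0) = beta n s) /\ (forall s, K n (s, I1) = beta' n s) /\
    (forall t, K n (I0, t) = x /\ K n (I1, t) = x)).
  { intros n. unfold K. destruct constructive_indefinite_description; auto. }
  apply (homotopic_placed K el (fun n => el (Datatypes.S n)) el (fun n => el (Datatypes.S n))); auto with el.
  - intros; apply HK.
  - intros; apply HK.
  - intros U HU Ux. destruct (HS U HU Ux) as [N HN]. exists N. intros n L p. apply (HN n L). apply HK.
  - replace (fun n t => K n (t, I0)) with beta.
    + apply prod_inf_placed. intros n. destruct (HK n) as [_ [_ [E [_ F]]]]. rewrite <- E. apply F.
    + extensionality n. extensionality t. symmetry. apply HK.
  - replace (fun n t => K n (t, I1)) with beta'.
    + apply prod_inf_placed. intros n. destruct (HK n) as [_ [_ [_ [E F]]]]. rewrite <- E. apply F.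
    + extensionality n. extensionality t. symmetry. apply HK.
Qed.

(** * Regrouping of omega-products *)

Definition interleave {Y : Type} (u v : nat -> Y) (k : nat) : Y :=
  if Nat.even k then u (Nat.div2 k) else v (Nat.div2 k).

Lemma interleave_even {Y : Type} (u v : nat -> Y) (n : nat) : interleave u v (2 * n) = u n.
Proof. unfold interleave. rewrite Nat.even_even. rewrite Nat.div2_double. auto. Qed.

Lemma interleave_odd {Y : Type} (u v : nat -> Y) (n : nat) : interleave u v (S (2 * n)) = v n.
Proof.
  unfold interleave. rewrite Nat.div2_succ_double. replace (S (2 * n)) with (2 * n + 1)%nat by lia.
  rewrite Nat.even_odd. auto.
Qed.

Lemma even_or_odd (k : nat) : exists n, k = (2 * n)%nat \/ k = S (2 * n).
Proof. destruct (Nat.Even_or_Odd k) as [[n E]|[n E]]; exists n; lia. Qed.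

Lemma null_seq_interleave (U V : nat -> I -> X) :
  null_seq opn x U -> null_seq opn x V -> null_seq opn x (interleave U V).
Proof.
  intros [U1 U2] [V1 V2]. split.
  - intros k. destruct (even_or_odd k) as [n [->| ->]]; rewrite ?interleave_even, ?interleave_odd; auto.
  - intros W HW Wx. destruct (U2 W HW Wx) as [N HN], (V2 W HW Wx) as [N' HN'].
    exists (2 * (N + N'))%nat. intros k Hk.
    destruct (even_or_odd k) as [n [->| ->]]; rewrite ?interleave_even, ?interleave_odd;
    [apply HN | apply HN']; lia.
Qed.

Ltac by_parity k :=
  let n := fresh "n" in destruct (even_or_odd k) as [n [->| ->]];
  rewrite ?interleave_even, ?interleave_odd.

Lemma placed_concat_refine (U V : nat -> I -> X) (a b : nat -> R) (P : I -> X) :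
  (forall n, a n < b n) -> (forall n, U n I1 = x) ->
  placed (fun n => concat (U n) (V n)) a b P ->
  placed (interleave U V) (interleave a (fun n => (a n + b n) / 2))
    (interleave (fun n => (a n + b n) / 2) b) P.
Proof.
  intros W E1 [P1 P2]. split.
  - intros k t. by_parity k; intros Ht; specialize (W n).
    + rewrite (P1 n) by lra. unfold concat.
      pose proof (ramp_bounds (a n) (b n) (val t) W ltac:(lra)).
      assert (E : 2 * ramp (a n) (b n) (val t) = ramp (a n) ((a n + b n) / 2) (val t))
        by (unfold ramp; field; lra).
      pose proof (ramp_inside (a n) ((a n + b n) / 2) (val t) ltac:(lra) Ht).
      rewrite val_clampI, E by lra. destruct Rle_dec; auto; exfalso; lra.
    + rewrite (P1 n) by lra. unfold concat.
      pose proof (ramp_bounds (a n) (b n) (val t) W ltac:(lra)).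
      assert (E : 2 * ramp (a n) (b n) (val t) - 1 = ramp ((a n + b n) / 2) (b n) (val t))
        by (unfold ramp; field; lra).
      pose proof (ramp_inside ((a n + b n) / 2) (b n) (val t) ltac:(lra) Ht).
      rewrite val_clampI, E by lra. destruct Rle_dec; auto; exfalso; lra.
  - intros t N. destruct (excluded_middle_informative (exists n, a n < val t < b n)) as [[n h]|h].
    + pose proof (N (2 * n)%nat) as N1. pose proof (N (S (2 * n))) as N2.
      rewrite !interleave_even in N1. rewrite !interleave_odd in N2.
      (* The midpoint lies in the whole interval but in neither open half; the value there is the
         end of [U n]. *)
      assert (E : val t = (a n + b n) / 2) by lra.
      rewrite (P1 n), E by auto. unfold concat.
      replace (ramp (a n) (b n) ((a n + b n) / 2)) with (1/2) by (unfold ramp; field; lra).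
      rewrite val_clampI by lra. destruct Rle_dec; [|exfalso; lra].
      rewrite clampI_ge1 by lra. auto.
    + apply P2. eauto.
Qed.

Lemma interleave_within (a b : nat -> R) : within a b ->
  within (interleave a (fun n => (a n + b n) / 2)) (interleave (fun n => (a n + b n) / 2) b).
Proof. intros W k. by_parity k; specialize (W n); lra. Qed.

Lemma interleave_consecutive (a b : nat -> R) : within a b -> consecutive a b ->
  consecutive (interleave a (fun n => (a n + b n) / 2)) (interleave (fun n => (a n + b n) / 2) b).
Proof.
  intros W O i j H. destruct (even_or_odd i) as [n [->| ->]], (even_or_odd j) as [m [->| ->]];
   rewrite ?interleave_even, ?interleave_odd; pose proof (W n); pose proof (W m);
   (destruct (Nat.eq_dec n m); [subst; try lia; lra | assert (L : (n < m)%nat) by lia; specialize (O n m L); lra]).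
Qed.

Lemma loop_endpoints (alpha : nat -> I -> X) : null_seq opn x alpha ->
  forall n, alpha n I0 = x /\ alpha n I1 = x.
Proof. intros [H _] n. apply H. Qed.

Lemma null_seq_concat (U V : nat -> I -> X) :
  null_seq opn x U -> null_seq opn x V -> null_seq opn x (fun n => concat (U n) (V n)).
Proof.
  intros [U1 U2] [V1 V2]. split.
  - intros n. apply loop_concat; auto.
  - intros W HW Wx. destruct (U2 W HW Wx) as [N HN], (V2 W HW Wx) as [N' HN'].
    exists (N + N')%nat. intros k Hk t. unfold concat. destruct Rle_dec; [apply HN | apply HN']; lia.
Qed.

Lemma null_seq_rev (U : nat -> I -> X) : null_seq opn x U -> null_seq opn x (fun n => rev (U n)).
Proof.
  intros [U1 U2]. split.
  - intros n. apply loop_rev; auto.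
  - intros W HW Wx. destruct (U2 W HW Wx) as [N HN].
    exists N. intros k Hk t. unfold rev. auto.
Qed.

Lemma null_seq_shift (U : nat -> I -> X) : null_seq opn x U -> null_seq opn x (fun n => U (S n)).
Proof.
  intros [U1 U2]. split; auto. intros W HW Wx. destruct (U2 W HW Wx) as [N HN].
  exists N. intros; apply HN; lia.
Qed.

(** Cutting every interval at its midpoint lists the factors in the order [U 0], [V 0], [U 1],
    [V 1], ..., again of type omega, so sliding the intervals suffices. *)
Lemma prod_inf_interleave (U V : nat -> I -> X) : null_seq opn x U -> null_seq opn x V ->
  prod_inf x (fun n => concat (U n) (V n)) =~ prod_inf x (interleave U V).
Proof.
  intros HU HV. pose proof (null_seq_interleave U V HU HV) as HI.
  pose proof (null_seq_concat U V HU HV) as HC.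
  eapply homotopic_placed_reorder; [| | |exact HI| |].
  3:{ apply consecutive_same_order; [|apply el_consecutive]. apply interleave_consecutive; auto with el. }
  - apply interleave_within. auto with el.
  - auto with el.
  - apply placed_concat_refine.
    + apply el_lt.
    + intros; apply loop_endpoints; auto.
    + apply prod_inf_placed. intros; apply (loop_endpoints _ HC).
  - apply prod_inf_placed. intros; apply (loop_endpoints _ HI).
Qed.

(** Interleaving only numbers the factors: on the line all intervals of [P] precede those of [Q].
    For two omega-products the order type is omega + omega, out of reach of [same_order] with
    [el]. *)
Lemma placed_concat (U V : nat -> I -> X) (a b a' b' : nat -> R) (P Q : I -> X) :
  within a b -> within a' b' -> P I1 = x ->
  placed U a b P -> placed V a' b' Q ->
  placed (interleave U V) (interleave (fun n => a n / 2) (fun n => (1 + a' n) / 2))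
    (interleave (fun n => b n / 2) (fun n => (1 + b' n) / 2)) (concat P Q).
Proof.
  intros W W' E [P1 P2] [Q1 Q2]. split.
  - intros k t. by_parity k; intros Ht; pose proof (W n); pose proof (W' n); unfold concat.
    + destruct Rle_dec; [|exfalso; lra]. rewrite (P1 n); rewrite val_clampI by lra; [|lra].
      f_equal. f_equal. unfold ramp. field. lra.
    + destruct Rle_dec; [exfalso; lra|]. rewrite (Q1 n); rewrite val_clampI by lra; [|lra].
      f_equal. f_equal. unfold ramp. field. lra.
  - intros t N. pose proof (I_bounds t). unfold concat. destruct Rle_dec as [r|r].
    + apply P2. intros n. rewrite val_clampI by lra. specialize (N (2 * n)%nat).
      rewrite !interleave_even in N. lra.
    + apply Q2. intros n. rewrite val_clampI by lra. specialize (N (S (2 * n))).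
      rewrite !interleave_odd in N. lra.
Qed.

(** The head gets the interval from 0 to 1/2 ([c] is one of these endpoints), and the tail is
    squeezed into the right half. *)
Definition cons_seq (c : R) (a : nat -> R) (n : nat) : R :=
  match n with O => c | S k => (1 + a k) / 2 end.

Lemma placed_cons (z : nat -> I -> X) (a b : nat -> R) (Q : I -> X) :
  within a b -> (z O I0 = x /\ z O I1 = x) -> Q I0 = x -> placed (fun n => z (S n)) a b Q ->
  placed z (cons_seq 0 a) (cons_seq (1/2) b) (concat (z O) Q).
Proof.
  intros W [E0 E1] EQ [Q1 Q2]. split.
  - intros [|n] t; simpl; intros Ht; unfold concat.
    + destruct Rle_dec; [|exfalso; lra]. f_equal. f_equal. unfold ramp. field.
    + pose proof (W n). destruct Rle_dec; [exfalso; lra|]. rewrite (Q1 n); rewrite val_clampI by lra; [|lra].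
      f_equal. f_equal. unfold ramp. field. lra.
  - intros t N. pose proof (I_bounds t). unfold concat. destruct Rle_dec as [r|r].
    + specialize (N O). simpl in N. destruct (Req_dec (val t) 0) as [e|e].
      * rewrite clampI_le0 by lra. auto.
      * rewrite clampI_ge1 by lra. auto.
    + apply Q2. intros n. rewrite val_clampI by lra. specialize (N (S n)). simpl in N. lra.
Qed.

Lemma prod_inf_cons (z : nat -> I -> X) : null_seq opn x z ->
  prod_inf x z =~ concat (z O) (prod_inf x (fun n => z (S n))).
Proof.
  intros Hz. pose proof (null_seq_shift z Hz) as Hz'.
  pose proof (prod_inf_loop _ Hz') as [_ [_ [L0 _]]].
  eapply homotopic_placed_reorder; [| | |exact Hz| |].
  5:{ apply placed_cons; [apply el_within| | |].
      - apply loop_endpoints; auto.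
      - exact L0.
      - apply prod_inf_placed. intros; apply (loop_endpoints z); auto. }
  - apply el_within.
  - intros [|n]; simpl; [lra|]. pose proof (el_within n). lra.
  - apply consecutive_same_order; auto with el. intros i j Hij.
    destruct j as [|j]; [lia|]. destruct i as [|i]; simpl.
    + pose proof (el_within j). lra.
    + pose proof (el_consecutive i j ltac:(lia)). lra.
  - apply prod_inf_placed. intros; apply loop_endpoints; auto.
Qed.

Lemma null_seq_sets (U : nat -> I -> X) : null_seq opn x U ->
  null_sets (fun n y => y = x \/ exists t, y = U n t).
Proof.
  intros [_ H] W HW Wx. destruct (H W HW Wx) as [N HN]. exists N.
  intros n Hn y [->|[t ->]]; auto.
Qed.

Lemma is_loop_own_image (g : I -> X) : is_loop opn all x g ->
  is_loop opn (fun y => y = x \/ exists t, y = g t) x g.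
Proof. apply is_loop_subset. eauto. Qed.

(* Regroup [P0 (P1^-1 P1) (P2^-1 P2) ...] and cancel each pair by a homotopy inside its own image. *)
Lemma prod_inf_telescope (P : nat -> I -> X) : null_seq opn x P ->
  prod_inf x (fun n => concat (P n) (rev (P (S n)))) =~ P O.
Proof.
  intros HP. pose proof (null_seq_shift P HP) as HP1. pose proof (null_seq_rev _ HP1) as HR.
  eapply homotopic_trans; [apply prod_inf_interleave; auto|].
  eapply homotopic_trans; [apply prod_inf_cons, null_seq_interleave; auto|].
  replace (interleave P (fun n => rev (P (S n))) 0) with (P O) by auto.
  eapply homotopic_trans; [|apply concat_1r; apply HP].
  apply homotopic_concat; [apply homotopic_refl, HP|].
  replace (fun n => interleave P (fun n => rev (P (S n))) (S n))
    with (interleave (fun n => rev (P (S n))) (fun n => P (S n))).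
  2:{ extensionality k. by_parity k; auto.
      replace (S (S (2 * n))) with (2 * (S n))%nat by lia. rewrite interleave_even. auto. }
  eapply homotopic_trans; [apply homotopic_sym, prod_inf_interleave; auto|].
  (* The constant loop is written as a product of constant loops, so that the factorwise
     cancellation applies. *)
  replace (fun _ : I => x) with (prod_inf x (fun _ _ => x)).
  2:{ extensionality t. unfold prod_inf. destruct excluded_middle_informative; auto. }
  apply (prod_inf_small_homotopy (fun n y => y = x \/ exists t, y = P (S n) t)).
  - apply (null_seq_sets _ HP1).
  - intros n. apply concat_revl, is_loop_own_image, HP1.
Qed.

End Placed.

(** * Infinite commutativity *)

(** Compactness of [0,1] in the form of a supremum argument: a property of intervals that adds up
    and holds near each point holds for the whole interval. *)
Lemma interval_induction (Q : R -> R -> Prop) :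
  (forall u v w, u <= v <= w -> Q u v -> Q v w -> Q u w) ->
  (forall t, 0 <= t <= 1 -> exists del, 0 < del /\
     forall u v, 0 <= u <= t -> t <= v <= 1 -> v - u < del -> Q u v) ->
  Q 0 1.
Proof.
  intros Htr Hloc.
  set (E := fun t => 0 <= t <= 1 /\ Q 0 t).
  destruct (completeness E) as [s [Hub Hlub]].
  - exists 1. intros t [Ht _]. lra.
  - exists 0. split; [lra|]. destruct (Hloc 0 ltac:(lra)) as [del [Hd K]]. apply K; lra.
  - assert (Hs0 : 0 <= s).
    { apply Hub. split; [lra|]. destruct (Hloc 0 ltac:(lra)) as [del [Hd K]]. apply K; lra. }
    assert (Hs1 : s <= 1) by (apply Hlub; intros t [Ht _]; lra).
    destruct (Hloc s ltac:(lra)) as [del [Hd K]].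
    destruct (excluded_middle_informative (exists t, E t /\ s - del / 2 < t)) as [[t [Et Ht]]|N].
    + pose proof (Hub t Et). destruct Et as [Bt Qt].
      assert (Qv : Q 0 (Rmin 1 (s + del / 4))).
      { apply Htr with t; auto; [|apply K]; minmax. }
      destruct (Rmin_cases 1 (s + del / 4)) as [[B E1]|[B E1]]; rewrite E1 in Qv; auto.
      exfalso. assert (E (s + del / 4)) by (split; [lra|auto]). apply Hub in H0. lra.
    + exfalso. assert (s <= s - del / 2); [|lra]. apply Hlub. intros t Et.
      apply Rnot_lt_le. intros L. apply N. eauto.
Qed.

Lemma rcont_piece (a b : R) : rcont dI (fun t : I => Rmin (Rmax (val t) a) b).
Proof. auto 10 with rc. Qed.

Section InfComm.
Context {X : Type} (opn : (X -> Prop) -> Prop) (x : X).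

Local Notation all := (fun _ : X => True).
Local Notation "g =~ h" := (homotopic opn all x g h) (at level 70).

(** Empty intervals are allowed, since an open set may have only finitely many components and the
    family is indexed by [nat]. *)
Definition supported (F : I -> X) (a b : nat -> R) : Prop :=
  (forall n, 0 <= a n /\ a n <= b n /\ b n <= 1) /\ separated a b /\
  (forall t, (forall n, ~ (a n < val t < b n)) -> F t = x).

Definition piece (F : I -> X) (a b : nat -> R) (n : nat) : I -> X :=
  fun t => F (clampI (Rmin (Rmax (val t) (a n)) (b n))).

Definition erase (F : I -> X) (a b : nat -> R) (n : nat) : I -> X := fun t =>
  if excluded_middle_informative (exists i, (i < n)%nat /\ a i < val t < b i) then x else F t.

(** * Erasing the pieces of a loop one after the other *)

Section Support.
Context (F : I -> X) (a b : nat -> R).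
Context (HF : is_loop opn all x F) (Hab : supported F a b).

Lemma supported_left (n : nat) : F (clampI (a n)) = x.
Proof.
  destruct Hab as [B [O Hx]]. apply Hx. intros m. pose proof (B n). pose proof (B m).
  rewrite val_clampI by lra. destruct (Nat.eq_dec n m) as [->|N]; [lra|]. destruct (O n m N); lra.
Qed.

Lemma supported_right (n : nat) : F (clampI (b n)) = x.
Proof.
  destruct Hab as [B [O Hx]]. apply Hx. intros m. pose proof (B n). pose proof (B m).
  rewrite val_clampI by lra. destruct (Nat.eq_dec n m) as [->|N]; [lra|]. destruct (O n m N); lra.
Qed.

(** By compactness it suffices to look near one point. Near a point of interval n no other interval
    occurs; near a point outside all intervals [F] is close to [x] by continuity. *)
Lemma supported_null (U : X -> Prop) : opn U -> U x ->
  exists N, forall n, (N <= n)%nat -> forall t, a n < val t < b n -> U (F t).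
Proof.
  intros HU Ux. destruct Hab as [B [O Hx]].
  assert (Q : exists N, forall n, (N <= n)%nat -> forall t : I, 0 <= val t <= 1 ->
    a n < val t < b n -> U (F t)).
  { apply (interval_induction (fun u v => exists N, forall n, (N <= n)%nat -> forall t : I,
      u <= val t <= v -> a n < val t < b n -> U (F t))).
    - intros u v w L [N HN] [N' HN']. exists (N + N')%nat. intros n Hn t Ht.
      destruct (Rle_dec (val t) v); [apply HN | apply HN']; try lia; lra.
    - intros t Ht.
      destruct (excluded_middle_informative (exists n, a n < t < b n)) as [[n h]|h].
      + exists (Rmin (t - a n) (b n - t)). split; [minmax|]. intros u v Hu Hv Huv.
        exists (S n). intros m Hm s Hs Hms. exfalso.
        pose proof (Rmin_l (t - a n) (b n - t)). pose proof (Rmin_r (t - a n) (b n - t)).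
        destruct (O n m ltac:(lia)); lra.
      + destruct (proj1 (proj2 HF) U HU (clampI t)) as [e [He K]].
        { rewrite Hx; auto. intros n. rewrite val_clampI by auto. eauto. }
        exists e. split; auto. intros u v Hu Hv Huv. exists 0%nat. intros n _ s Hs _.
        apply K. unfold dI. rewrite val_clampI by auto. apply Rabs_def1; lra. }
  destruct Q as [N HN]. exists N. intros n Hn t. apply HN; auto. apply I_bounds.
Qed.

Lemma piece_outside (n : nat) (t : I) : ~ (a n < val t < b n) -> piece F a b n t = x.
Proof.
  intros H. destruct Hab as [B _]. pose proof (B n). unfold piece.
  destruct (Rle_dec (val t) (a n)).
  - rewrite Rmax_right, Rmin_left by lra. apply supported_left.
  - rewrite Rmax_left, Rmin_right by lra. apply supported_right.
Qed.

Lemma piece_inside (n : nat) (t : I) : a n < val t < b n -> piece F a b n t = F t.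
Proof. intros H. unfold piece. rewrite Rmax_left, Rmin_left, clampI_val by lra. auto. Qed.

Lemma piece_loop (n : nat) : is_loop opn all x (piece F a b n).
Proof.
  destruct Hab as [B _]. pose proof (B n). split; [|split; [|split]]; auto.
  - apply (pcont_clamp opn F); [exact (proj1 (proj2 HF)) | apply rcont_piece].
  - apply piece_outside. simpl. lra.
  - apply piece_outside. simpl. lra.
Qed.

Lemma piece_null : null_seq opn x (piece F a b).
Proof.
  split; [apply piece_loop|]. intros U HU Ux. destruct (supported_null U HU Ux) as [N HN].
  exists N. intros n Hn t. destruct (excluded_middle_informative (a n < val t < b n)) as [h|h].
  - rewrite piece_inside; eauto.
  - rewrite piece_outside; auto.
Qed.

Lemma erase_keep (n i : nat) (t : I) : (n <= i)%nat -> a i <= val t <= b i ->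
  erase F a b n t = F t.
Proof.
  intros L Ht. unfold erase. destruct excluded_middle_informative as [[j [Lj Hj]]|]; auto.
  exfalso. destruct Hab as [_ [O _]]. destruct (O i j ltac:(lia)); lra.
Qed.

Lemma erase_off (n : nat) (t : I) : (forall i, ~ (a i < val t < b i)) -> erase F a b n t = x.
Proof.
  intros H. unfold erase. destruct excluded_middle_informative as [[j [Lj Hj]]|]; auto.
  apply Hab; auto.
Qed.

Lemma erase_S_off (n : nat) (t : I) : ~ (a n < val t < b n) -> erase F a b (S n) t = erase F a b n t.
Proof.
  intros H. unfold erase.
  destruct excluded_middle_informative as [[j [Lj Hj]]|N], excluded_middle_informative as [[k [Lk Hk]]|N']; auto.
  - exfalso. apply N'. exists j. split; auto. destruct (Nat.eq_dec j n); [subst; contradiction | lia].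
  - exfalso. apply N. exists k. split; auto.
Qed.

Lemma erase_S_inside (n : nat) (t : I) : a n <= val t <= b n -> erase F a b (S n) t = x.
Proof.
  intros H. destruct (excluded_middle_informative (a n < val t < b n)) as [h|h].
  - unfold erase. destruct excluded_middle_informative as [|N]; auto. exfalso. apply N. eauto.
  - apply erase_off. intros i Hi. destruct Hab as [_ [O _]].
    destruct (Nat.eq_dec n i); [subst; contradiction|]. destruct (O n i n0); lra.
Qed.

Lemma erase_O : erase F a b 0 = F.
Proof. extensionality t. unfold erase. destruct excluded_middle_informative as [[j [Lj _]]|]; auto. lia. Qed.

(** Each [erase F a b n] is glued from the pieces of index at least n, with constants in the places
    of the earlier ones. Its values are [x] or values of these late pieces, which are small by
    [supported_null]. *)
Lemma erase_null : null_seq opn x (erase F a b).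
Proof.
  split.
  - intros n. destruct Hab as [B _].
    split; [|split; [|split]]; auto.
    + apply (glue_cont opn x (fun i (t : I) => a i < val t < b i)
        (fun i => if Nat.ltb i n then fun _ => x else piece F a b i)).
      * intros i t [h1 h2]. apply near_and; apply near_lt; auto with rc.
      * intros i t h. destruct (Nat.ltb_spec i n).
        -- unfold erase. destruct excluded_middle_informative as [|N]; auto. exfalso; eauto.
        -- rewrite piece_inside, (erase_keep n i); auto; lra.
      * apply erase_off.
      * intros i t h. destruct (Nat.ltb_spec i n); auto. apply piece_outside; auto.
      * intros i. destruct (Nat.ltb_spec i n); [apply pcont_const | exact (proj1 (proj2 (piece_loop i)))].
      * intros U HU Ux. destruct piece_null as [_ K]. destruct (K U HU Ux) as [N HN].
        exists N. intros i Hi t. destruct (Nat.ltb_spec i n); auto.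
    + apply erase_off. intros i. pose proof (B i). simpl. lra.
    + apply erase_off. intros i. pose proof (B i). simpl. lra.
  - intros U HU Ux. destruct (supported_null U HU Ux) as [N HN]. exists N. intros n Hn t.
    destruct (excluded_middle_informative (exists i, a i < val t < b i)) as [[i h]|h].
    + unfold erase. destruct excluded_middle_informative as [|N']; auto.
      apply (HN i); auto. destruct (Nat.le_gt_cases n i); [lia|]. exfalso; eauto.
    + rewrite erase_off; eauto.
Qed.

Definition left_part (n : nat) : I -> X := fun t => erase F a b n (clampI (Rmin (val t) (a n))).

Definition right_part (n : nat) : I -> X := fun t => erase F a b n (clampI (Rmax (val t) (b n))).

Definition erase_image (n : nat) (y : X) : Prop := y = x \/ exists t, y = erase F a b n t.

Lemma erase_loop_image (n : nat) : is_loop opn (erase_image n) x (erase F a b n).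
Proof. apply is_loop_own_image, erase_null. Qed.

Lemma erase_left (n : nat) : erase F a b n (clampI (a n)) = x.
Proof.
  destruct Hab as [B _]. pose proof (B n).
  rewrite (erase_keep n n), supported_left; auto. rewrite val_clampI; lra.
Qed.

Lemma erase_right (n : nat) : erase F a b n (clampI (b n)) = x.
Proof.
  destruct Hab as [B _]. pose proof (B n).
  rewrite (erase_keep n n), supported_right; auto. rewrite val_clampI; lra.
Qed.

Lemma left_part_loop (n : nat) : is_loop opn (erase_image n) x (left_part n).
Proof.
  destruct Hab as [B _]. pose proof (B n).
  apply loop_restrict_l; [apply erase_loop_image | lra | apply erase_left].
Qed.

Lemma right_part_loop (n : nat) : is_loop opn (erase_image n) x (right_part n).
Proof.
  destruct Hab as [B _]. pose proof (B n).
  apply loop_restrict_r; [apply erase_loop_image | lra | apply erase_right].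
Qed.

(** Stage n has not yet touched interval n. Hence piece n lies in [erase_image n], the set to which
    the n-th homotopy is confined. *)
Lemma piece_erase (n : nat) (t : I) :
  piece F a b n t = erase F a b n (clampI (Rmin (Rmax (val t) (a n)) (b n))).
Proof.
  destruct Hab as [B _]. pose proof (B n). pose proof (I_bounds t).
  rewrite (erase_keep n n); auto. rewrite val_clampI; minmax.
Qed.

Lemma piece_loop_image (n : nat) : is_loop opn (erase_image n) x (piece F a b n).
Proof. apply is_loop_subset with (S := all); [|apply piece_loop]. intros t. right. rewrite piece_erase. eauto. Qed.

Lemma erase_split (n : nat) : homotopic opn (erase_image n) x (erase F a b n)
  (concat (left_part n) (concat (piece F a b n) (right_part n))).
Proof.
  destruct Hab as [B _]. pose proof (B n).
  pose proof (erase_loop_image n) as HE. pose proof (erase_left n). pose proof (erase_right n).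
  eapply homotopic_trans; [apply (concat_split opn _ x _ (a n)); auto; lra|].
  apply homotopic_concat; [apply homotopic_refl, left_part_loop|].
  eapply homotopic_trans; [apply (concat_split opn _ x _ (b n))|].
  - apply loop_restrict_r; auto. lra.
  - lra.
  - rewrite val_clampI, Rmax_left by lra. auto.
  - apply homotopic_concat.
    + replace (piece F a b n) with
        (fun t : I => erase F a b n (clampI (Rmax (val (clampI (Rmin (val t) (b n)))) (a n)))).
      * apply homotopic_refl. change (fun t : I => erase F a b n
          (clampI (Rmax (val (clampI (Rmin (val t) (b n)))) (a n)))) with
          (fun t : I => (fun s : I => erase F a b n (clampI (Rmax (val s) (a n)))) (clampI (Rmin (val t) (b n)))).
        apply loop_restrict_l.
        -- apply loop_restrict_r; auto. lra.
        -- lra.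
        -- rewrite val_clampI, Rmax_left by lra. auto.
      * extensionality t. rewrite piece_erase. pose proof (I_bounds t). f_equal. f_equal.
        rewrite val_clampI; minmax.
    + replace (fun t : I => erase F a b n (clampI (Rmax (val (clampI (Rmax (val t) (b n)))) (a n))))
       with (right_part n); [apply homotopic_refl, right_part_loop|].
      extensionality t. pose proof (I_bounds t). unfold right_part. f_equal. f_equal.
      rewrite val_clampI; minmax.
Qed.

Lemma erase_S_image (n : nat) (t : I) : erase_image n (erase F a b (S n) t).
Proof.
  destruct (excluded_middle_informative (a n < val t < b n)) as [h|h].
  - left. apply erase_S_inside. lra.
  - right. exists t. apply erase_S_off; auto.
Qed.

(** The loop is now constant between [a n] and [b n], so one cut at [a n] suffices: the remainder
    coincides with [right_part n]. Together with [erase_split] this presents two successive stages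
    as L F R and L R with the same L and R. *)
Lemma erase_S_split (n : nat) : homotopic opn (erase_image n) x (erase F a b (S n))
  (concat (left_part n) (right_part n)).
Proof.
  destruct Hab as [B _]. pose proof (B n).
  eapply homotopic_trans; [apply (concat_split opn _ x _ (a n))|].
  - apply is_loop_subset with (S := all); [apply erase_S_image | apply erase_null].
  - lra.
  - apply erase_S_inside. rewrite val_clampI; lra.
  - replace (fun t : I => erase F a b (S n) (clampI (Rmin (val t) (a n)))) with (left_part n).
    2:{ extensionality t. pose proof (I_bounds t). unfold left_part. rewrite erase_S_off; auto.
        rewrite val_clampI; minmax. }
    replace (fun t : I => erase F a b (S n) (clampI (Rmax (val t) (a n)))) with (right_part n).
    2:{ extensionality t. pose proof (I_bounds t). unfold right_part.
        destruct (Rle_dec (val t) (b n)).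
        - rewrite Rmax_right, erase_right by lra. symmetry. apply erase_S_inside.
          rewrite val_clampI; minmax.
        - rewrite !Rmax_left by lra. rewrite clampI_val, erase_S_off; auto. lra. }
    apply homotopic_concat; apply homotopic_refl; [apply left_part_loop | apply right_part_loop].
Qed.

End Support.

(** * Consequences of infinite commutativity *)

Definition swap_parity (k : nat) : nat := if Nat.even k then S k else Nat.pred k.

Lemma swap_parity_bij : bijective_nat swap_parity.
Proof.
  assert (E : forall n, swap_parity (2 * n) = S (2 * n)).
  { intros. unfold swap_parity. rewrite Nat.even_even. auto. }
  assert (O : forall n, swap_parity (S (2 * n)) = (2 * n)%nat).
  { intros. unfold swap_parity. replace (Nat.even (S (2 * n))) with false; auto.
    replace (S (2 * n)) with (2 * n + 1)%nat by lia. rewrite Nat.even_odd. auto. }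
  split.
  - intros m n. destruct (even_or_odd m) as [i [->| ->]], (even_or_odd n) as [j [->| ->]];
      rewrite ?E, ?O; lia.
  - intros n. destruct (even_or_odd n) as [i [->| ->]]; [exists (S (2 * i)) | exists (2 * i)%nat]; auto.
Qed.

Context (Hcomm : inf_comm opn x).

(** The hypothesis [Hcomm] is applied to one permutation: after interleaving, the two sides differ
    by the exchange of [2 n] and [2 n + 1]. *)
Lemma prod_inf_swap (U V : nat -> I -> X) : null_seq opn x U -> null_seq opn x V ->
  prod_inf x (fun n => concat (U n) (V n)) =~ prod_inf x (fun n => concat (V n) (U n)).
Proof.
  intros HU HV.
  eapply homotopic_trans; [apply prod_inf_interleave; auto|].
  eapply homotopic_trans; [|apply homotopic_sym, prod_inf_interleave; auto].
  replace (interleave V U) with (fun n => interleave U V (swap_parity n)).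
  - apply Hcomm; [apply null_seq_interleave; auto | apply swap_parity_bij].
  - extensionality k. unfold swap_parity. destruct (even_or_odd k) as [n [->| ->]].
    + rewrite Nat.even_even, interleave_odd, interleave_even. auto.
    + replace (Nat.even (S (2 * n))) with false.
      * simpl Nat.pred. rewrite interleave_odd. apply interleave_even.
      * replace (S (2 * n)) with (2 * n + 1)%nat by lia. rewrite Nat.even_odd. auto.
Qed.

(* With [P n] the loop [F] with the first [n] pieces erased and [L n] the part of [P n] to the left
   of piece [n], each piece is [(piece n . L n^-1) . L n]. Swapping the two factors, for all [n] at
   once, turns it into [L n . piece n . L n^-1], which is [P n . P (n+1)^-1]; the product of the
   latter telescopes to [P 0]. *)
Theorem prod_inf_pieces (F : I -> X) (a b : nat -> R) :
  is_loop opn all x F -> supported F a b -> F =~ prod_inf x (piece F a b).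
Proof.
  intros HF Hab. apply homotopic_sym.
  pose proof (erase_null F a b HF Hab) as HE.
  assert (HS : null_sets opn x (erase_image F a b)) by (apply null_seq_sets; auto).
  assert (HL : null_seq opn x (left_part F a b)).
  { split.
    - intros n. apply is_loop_subset with (S := erase_image F a b n); auto. apply left_part_loop; auto.
    - intros U HU Ux. destruct (HS U HU Ux) as [N HN]. exists N. intros n Hn t. apply (HN n Hn).
      right. eexists. reflexivity. }
  pose proof (null_seq_rev opn x _ HL) as HrL.
  pose proof (piece_null F a b HF Hab) as HP.
  eapply homotopic_trans;
   [|eapply homotopic_trans; [apply (prod_inf_swap (fun n => concat (piece F a b n) (rev (left_part F a b n))) (left_part F a b))|]].
  - apply (prod_inf_small_homotopy opn x (erase_image F a b)); auto.
    intros n. apply homotopic_sym, concat_rev_cancel_r; [apply piece_loop_image | apply left_part_loop]; auto.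
  - apply null_seq_concat; auto.
  - auto.
  - pose proof (prod_inf_telescope opn x _ HE) as HT. rewrite erase_O in HT.
    eapply homotopic_trans; [|exact HT].
    apply (prod_inf_small_homotopy opn x (erase_image F a b)); auto.
    intros n. apply conjugate_quotient with (R := right_part F a b n).
    + apply left_part_loop; auto.
    + apply piece_loop_image; auto.
    + apply right_part_loop; auto.
    + apply erase_split; auto.
    + apply erase_S_split; auto.
Qed.

(** The n-th piece of [P] is [alpha n] run on a subinterval and constant elsewhere, hence homotopic
    to [alpha n] within the image of [alpha n]. *)
Lemma placed_prod_inf (alpha : nat -> I -> X) (a b : nat -> R) (P : I -> X) :
  within a b -> separated a b -> null_seq opn x alpha -> placed x alpha a b P ->
  P =~ prod_inf x alpha.
Proof.
  intros W O Ha HP. pose proof (loop_placed opn x alpha a b P W O Ha HP) as LP.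
  assert (HS : supported P a b).
  { split; [|split]; auto.
    - intros n. specialize (W n). lra.
    - apply HP. }
  eapply homotopic_trans; [apply (prod_inf_pieces P a b); auto|].
  apply (prod_inf_small_homotopy opn x (fun n y => y = x \/ exists t, y = alpha n t)).
  - apply null_seq_sets; auto.
  - intros n. pose proof (W n) as Wn. apply homotopic_sym.
    apply (reparam_id opn _ x (alpha n) _ (fun t : I => ramp (a n) (b n) (Rmin (Rmax (val t) (a n)) (b n)))).
    + apply is_loop_own_image, Ha.
    + unfold ramp. apply rcont_div; auto 10 with rc. intros; lra.
    + simpl. rewrite Rmax_right, Rmin_left by lra. unfold ramp. field. lra.
    + simpl. rewrite Rmax_left, Rmin_right by lra. unfold ramp. field. lra.
    + intros t. unfold piece.
      assert (B : a n <= Rmin (Rmax (val t) (a n)) (b n) <= b n) by minmax.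
      rewrite (placed_closed x alpha a b P) with (n := n); auto; rewrite ?val_clampI; auto; try lra.
      * intros m. apply Ha.
Qed.

End InfComm.

(** * Components of open sets of reals *)

(** The endpoint is the supremum of the points up to [t] outside [A]; it lies outside [A] because
    [A] is open. *)
Lemma component_left (A : R -> Prop) (t : R) :
  (forall s, A s -> exists e, 0 < e /\ forall r, Rabs (s - r) < e -> A r) ->
  ~ A 0 -> 0 <= t -> A t ->
  exists u, 0 <= u /\ u < t /\ ~ A u /\ forall s, u < s <= t -> A s.
Proof.
  intros Ho A0 Ht At.
  destruct (completeness (fun s => s <= t /\ ~ A s)) as [u [Hub Hlub]].
  - exists t. intros s [Hs _]. auto.
  - exists 0. auto.
  - assert (NA : ~ A u).
    { intros Au. destruct (Ho u Au) as [e [He K]]. assert (u <= u - e); [|lra].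
      apply Hlub. intros s Hs. pose proof (Hub s Hs) as Hsu. apply Rnot_lt_le. intros L.
      destruct Hs as [_ Hs]. apply Hs, K. apply Rabs_def1; lra. }
    assert (Hut : u <= t) by (apply Hlub; intros s [Hs _]; auto).
    exists u. split; [|split; [|split]]; auto.
    + destruct Hut as [|E]; auto. subst; contradiction.
    + intros s Hs. destruct (excluded_middle_informative (A s)) as [|N]; auto.
      exfalso. assert (s <= u) by (apply Hub; split; [lra|auto]). lra.
Qed.

Lemma component_exists (A : R -> Prop) (t : R) :
  (forall s, A s -> exists e, 0 < e /\ forall r, Rabs (s - r) < e -> A r) ->
  (forall s, A s -> 0 < s < 1) -> A t ->
  exists uv : R * R, 0 <= fst uv /\ fst uv < t < snd uv /\ snd uv <= 1 /\
    ~ A (fst uv) /\ ~ A (snd uv) /\ forall s, fst uv < s < snd uv -> A s.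
Proof.
  intros Ho HA At. pose proof (HA t At).
  destruct (component_left A t) as [u [U0 [U1 [U2 U3]]]]; auto; try lra.
  { intros K. apply HA in K. lra. }
  (* The right endpoint is the left endpoint of the mirror image under [1 - s]. *)
  destruct (component_left (fun s => A (1 - s)) (1 - t)) as [w [W0 [W1 [W2 W3]]]]; try lra.
  - intros s As. destruct (Ho _ As) as [e [He K]]. exists e. split; auto. intros r Hr. apply K.
    replace (1 - s - (1 - r)) with (- (s - r)) by ring. rewrite Rabs_Ropp. auto.
  - intros K. apply HA in K. lra.
  - replace (1 - (1 - t)) with t by ring. auto.
  - exists (u, 1 - w). simpl. split; [|split; [|split; [|split; [|split]]]]; auto; try lra.
    intros s Hs. destruct (Rle_dec s t); [apply U3; lra|].
    replace s with (1 - (1 - s)) by ring. apply W3. lra.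
Qed.

(** An enumeration, with repetitions, of the nonnegative rationals; it serves to number the
    components by [nat]. *)
Definition ratio (n : nat) : R := INR (fst (Cantor.of_nat n)) / INR (S (snd (Cantor.of_nat n))).

Lemma ratio_dense (u v : R) : 0 <= u < v -> exists n, u < ratio n < v.
Proof.
  intros [Hu Huv].
  destruct (archimed_cor1 (v - u)) as [k [Hk Hk0]]; [lra|].
  destruct k as [|j]; [lia|]. set (K := INR (S j)) in *.
  assert (HK : 0 < K) by (apply lt_0_INR; lia).
  destruct (archimed (u * K)) as [H1 H2].
  assert (Hup : (0 <= up (u * K))%Z) by (apply le_IZR; nra).
  exists (Cantor.to_nat (Z.to_nat (up (u * K)), j)). unfold ratio. rewrite Cantor.cancel_of_to. simpl fst; simpl snd.
  fold K. rewrite INR_IZR_INZ, Z2Nat.id by auto.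
  assert (HKi : / K * K = 1) by (apply Rinv_l; lra).
  split; apply Rmult_lt_reg_r with K; auto; unfold Rdiv; rewrite Rmult_assoc, HKi; nra.
Qed.

(** Every component contains some [ratio n] and is listed at the least such n; all other indices get
    the empty interval (0, 0). An empty interval at 0 is separated from every subinterval of [0,1],
    so these fillers do no harm. *)
Lemma components (A : R -> Prop) :
  (forall s, A s -> exists e, 0 < e /\ forall r, Rabs (s - r) < e -> A r) ->
  (forall s, A s -> 0 < s < 1) ->
  exists ab : (nat -> R) * (nat -> R),
    (forall n, 0 <= fst ab n /\ fst ab n <= snd ab n /\ snd ab n <= 1) /\
    (forall n, fst ab n = snd ab n -> fst ab n = 0) /\
    separated (fst ab) (snd ab) /\
    (forall n t, fst ab n < t < snd ab n -> A t) /\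
    (forall t, A t -> exists n, fst ab n < t < snd ab n) /\
    (forall n, ~ A (fst ab n) /\ ~ A (snd ab n)).
Proof.
  intros Ho HA.
  assert (N0 : ~ A 0) by (intros K; apply HA in K; lra).
  pose (isc := fun (t : R) (uv : R * R) => 0 <= fst uv /\ fst uv < t < snd uv /\ snd uv <= 1 /\
    ~ A (fst uv) /\ ~ A (snd uv) /\ forall s, fst uv < s < snd uv -> A s).
  assert (Huniq : forall t t' uv uv' s, isc t uv -> isc t' uv' ->
    fst uv < s < snd uv -> fst uv' < s < snd uv' -> uv = uv').
  { intros t t' [u v] [u' v'] s [I0' [I1' [I2' [I3 [I4 I5]]]]] [J0 [J1 [J2 [J3 [J4 J5]]]]] K K'.
    simpl in *. f_equal.
    - destruct (Rtotal_order u u') as [L|[L|L]]; auto; exfalso; [apply J3, I5 | apply I3, J5]; lra.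
    - destruct (Rtotal_order v v') as [L|[L|L]]; auto; exfalso; [apply I4, J5 | apply J4, I5]; lra. }
  set (cmp := fun t => match excluded_middle_informative (A t) with
    | left h => proj1_sig (constructive_indefinite_description _ (component_exists A t Ho HA h))
    | right _ => (0, 0) end).
  assert (Hcmp : forall t, A t -> isc t (cmp t)).
  { intros t At. unfold cmp. destruct excluded_middle_informative; [|contradiction].
    destruct constructive_indefinite_description; auto. }
  set (first := fun n => A (ratio n) /\
    forall j, (j < n)%nat -> ~ (fst (cmp (ratio n)) < ratio j < snd (cmp (ratio n)))).
  set (ab := fun n => if excluded_middle_informative (first n) then cmp (ratio n) else (0, 0)).
  assert (Hab : forall n, (first n /\ ab n = cmp (ratio n) /\ isc (ratio n) (ab n)) \/ ab n = (0, 0)).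
  { intros n. unfold ab. destruct excluded_middle_informative as [h|h]; auto.
    left. split; [|split]; auto. apply Hcmp, h. }
  exists (fun n => fst (ab n), fun n => snd (ab n)). simpl.
  split; [|split; [|split; [|split; [|split]]]].
  - intros n. destruct (Hab n) as [[_ [_ [? [? [? _]]]]]|E]; [lra | rewrite E; simpl; lra].
  - intros n. destruct (Hab n) as [[_ [_ [? [? [? _]]]]]|E]; [lra | rewrite E; simpl; lra].
  - assert (Hlt : forall i j, (i < j)%nat -> snd (ab i) <= fst (ab j) \/ snd (ab j) <= fst (ab i)).
    { intros i j Lij.
      destruct (Hab i) as [[Fi [Ei Ci]]|E]; [|rewrite E; simpl; left; destruct (Hab j) as [[_ [_ [? _]]]|E']; [lra | rewrite E'; simpl; lra]].
      destruct (Hab j) as [[Fj [Ej Cj]]|E]; [|rewrite E; simpl; right; destruct Ci; lra].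
      destruct (Rle_dec (snd (ab i)) (fst (ab j))) as [|N1]; auto.
      destruct (Rle_dec (snd (ab j)) (fst (ab i))) as [|N2]; auto.
      exfalso. pose proof Ci as [_ [Bi _]]. pose proof Cj as [_ [Bj _]].
      (* The midpoint of the overlap lies in both components, which must then be equal; this
         contradicts the minimality of [j]. *)
      set (s := (Rmax (fst (ab i)) (fst (ab j)) + Rmin (snd (ab i)) (snd (ab j))) / 2).
      assert (Eij : ab i = ab j).
      { apply (Huniq _ _ _ _ s Ci Cj); unfold s; minmax. }
      destruct Fj as [_ Fj]. apply (Fj i Lij). rewrite <- Ej, <- Eij. auto. }
    intros i j Nij. destruct (Nat.lt_gt_cases i j) as [K _]. destruct (K Nij) as [L|L].
    + apply Hlt; auto.
    + destruct (Hlt j i L); auto.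
  - intros n t Ht. destruct (Hab n) as [[_ [_ C]]|E]; [apply C; auto | rewrite E in Ht; simpl in Ht; lra].
  - intros t At. pose proof (Hcmp t At) as Ct.
    assert (Hex : exists n, fst (cmp t) < ratio n < snd (cmp t)) by (apply ratio_dense; destruct Ct; lra).
    destruct (dec_inh_nat_subset_has_unique_least_element (fun n => fst (cmp t) < ratio n < snd (cmp t)))
      as [n [[Hn Hmin] _]]; auto.
    { intros n. destruct (excluded_middle_informative (fst (cmp t) < ratio n < snd (cmp t))); auto. }
    assert (An : A (ratio n)) by (apply Ct; auto).
    assert (E : cmp (ratio n) = cmp t).
    { apply (Huniq _ _ _ _ (ratio n) (Hcmp _ An) Ct); auto. apply (Hcmp _ An). }
    exists n. unfold ab. destruct excluded_middle_informative as [h|h].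
    + rewrite E. apply Ct.
    + exfalso. apply h. split; auto. rewrite E. intros j Lj Hj. apply Hmin in Hj. lia.
  - intros n. destruct (Hab n) as [[_ [_ [? [? [? [? [? _]]]]]]]|E]; auto. rewrite E; auto.
Qed.

Lemma Rmax_mix (u v p q : R) : u < v -> Rmax (mix u v p) (mix u v q) = mix u v (Rmax p q).
Proof.
  intros. destruct (Rmax_cases p q) as [[L ->]|[L ->]];
   [apply Rmax_right | apply Rmax_left]; unfold mix; nra.
Qed.

Lemma Rmin_mix (u v p q : R) : u < v -> Rmin (mix u v p) (mix u v q) = mix u v (Rmin p q).
Proof.
  intros. destruct (Rmin_cases p q) as [[L ->]|[L ->]];
   [apply Rmin_left | apply Rmin_right]; unfold mix; nra.
Qed.

Lemma mix_mono (u v p q : R) : u < v -> p <= q -> mix u v p <= mix u v q.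
Proof. intros; unfold mix; nra. Qed.

Section Shuffle.
Context {X : Type} (opn : (X -> Prop) -> Prop) (x : X).
Context (Hcomm : inf_comm opn x).

Local Notation all := (fun _ : X => True).
Local Notation "g =~ h" := (homotopic opn all x g h) (at level 70).

(* Both sides are infinite products of the same loops, one for each component of each [A k],
   placed along two different families of intervals. *)
Theorem prod_inf_shuffle (A : nat -> R -> Prop) (F : I -> X) (Fk : nat -> I -> X) :
  (forall k s, A k s -> exists e, 0 < e /\ forall r, Rabs (s - r) < e -> A k r) ->
  (forall k s, A k s -> 0 < s < 1) ->
  (forall k l s, A k s -> A l s -> k = l) ->
  is_loop opn all x F -> null_seq opn x Fk ->
  (forall k t, A k (val t) -> Fk k t = F t) ->
  (forall k t, ~ A k (val t) -> Fk k t = x) ->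
  (forall t, (forall k, ~ A k (val t)) -> F t = x) ->
  F =~ prod_inf x Fk.
Proof.
  intros Ho HA Hd LF LFk FA FN F0.
  set (ab := fun k => proj1_sig (constructive_indefinite_description _ (components (A k) (Ho k) (HA k)))).
  assert (Hab : forall k,
    (forall n, 0 <= fst (ab k) n /\ fst (ab k) n <= snd (ab k) n /\ snd (ab k) n <= 1) /\
    (forall n, fst (ab k) n = snd (ab k) n -> fst (ab k) n = 0) /\
    separated (fst (ab k)) (snd (ab k)) /\
    (forall n t, fst (ab k) n < t < snd (ab k) n -> A k t) /\
    (forall t, A k t -> exists n, fst (ab k) n < t < snd (ab k) n) /\
    (forall n, ~ A k (fst (ab k) n) /\ ~ A k (snd (ab k) n))).
  { intros k. unfold ab. destruct constructive_indefinite_description; auto. }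
  clearbody ab.
  (* The number [m] codes a pair: component [J m] of the set [A (K m)]. *)
  set (K := fun m => fst (Cantor.of_nat m)). set (J := fun m => snd (Cantor.of_nat m)).
  assert (KJ : forall m m', m <> m' -> K m <> K m' \/ (K m = K m' /\ J m <> J m')).
  { intros m m' N. destruct (Nat.eq_dec (K m) (K m')) as [E|]; auto. right. split; auto. intros E'.
    apply N. rewrite <- (Cantor.cancel_to_of m), <- (Cantor.cancel_to_of m'). f_equal.
    unfold K, J in *. destruct (Cantor.of_nat m), (Cantor.of_nat m'). simpl in *. congruence. }
  set (a := fun m => fst (ab (K m)) (J m)). set (b := fun m => snd (ab (K m)) (J m)).
  assert (B : forall m, 0 <= a m /\ a m <= b m /\ b m <= 1) by (intros m; apply Hab).
  assert (Cov : forall k t, A k t -> exists m, K m = k /\ a m < t < b m).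
  { intros k t At. destruct (Hab k) as [_ [_ [_ [_ [C _]]]]]. destruct (C t At) as [i Hi].
    exists (Cantor.to_nat (k, i)). unfold a, b, K, J. rewrite Cantor.cancel_of_to. auto. }
  assert (SF : supported x F a b).
  { split; [|split]; auto.
    - intros m m' N. destruct (KJ m m' N) as [N'|[E N']].
      + destruct (Rle_dec (b m) (a m')) as [|N1]; auto. destruct (Rle_dec (b m') (a m)) as [|N2]; auto.
        exfalso. pose proof (B m). pose proof (B m').
        destruct (Hab (K m)) as [_ [Z [_ [C _]]]]. destruct (Hab (K m')) as [_ [Z' [_ [C' _]]]].
        specialize (Z (J m)). specialize (Z' (J m')). fold (a m) (b m) in Z. fold (a m') (b m') in Z'.
        (* An empty interval would sit at 0 and be separated; so both intervals have interior, and
           the midpoint of their overlap would lie in two different sets [A k]. *)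
        assert (a m < b m) by (destruct (Req_dec (a m) (b m)) as [e|e]; [specialize (Z e) | ]; lra).
        assert (a m' < b m') by (destruct (Req_dec (a m') (b m')) as [e|e]; [specialize (Z' e) | ]; lra).
        set (s := (Rmax (a m) (a m') + Rmin (b m) (b m')) / 2).
        apply N', (Hd _ _ s); [apply (C (J m)) | apply (C' (J m'))]; fold (a m) (b m) (a m') (b m'); unfold s; minmax.
      + unfold a, b. rewrite <- E. destruct (Hab (K m)) as [_ [_ [S _]]]. apply S; auto.
    - intros t N. apply F0. intros k At. destruct (Cov k _ At) as [m [_ Hm]]. apply (N m); auto. }
  set (G := prod_inf x Fk).
  assert (Ends : forall n, Fk n I0 = x /\ Fk n I1 = x) by (apply (loop_endpoints opn x Fk); auto).
  assert (PG : placed x Fk el (fun n => el (S n)) G) by (apply prod_inf_placed; intros; apply Ends).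
  assert (LG : is_loop opn all x G) by (apply prod_inf_loop; auto).
  (* The same component as it appears in [G]: factor [K m] occupies the slot from [el (K m)] to
     [el (S (K m))], and the component is carried there affinely. *)
  set (a' := fun m => mix (el (K m)) (el (S (K m))) (a m)).
  set (b' := fun m => mix (el (K m)) (el (S (K m))) (b m)).
  assert (B' : forall m, el (K m) <= a' m /\ a' m <= b' m /\ b' m <= el (S (K m))).
  { intros m. pose proof (B m). pose proof (el_lt (K m)). unfold a', b'.
    split; [|split; [apply mix_mono; tauto|]].
    - replace (el (K m)) with (mix (el (K m)) (el (S (K m))) 0) at 1 by (unfold mix; ring). apply mix_mono; tauto.
    - replace (el (S (K m))) with (mix (el (K m)) (el (S (K m))) 1) at 2 by (unfold mix; ring). apply mix_mono; tauto. }
  assert (SG : supported x G a' b').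
  { split; [|split].
    - intros m. pose proof (B' m). pose proof (el_within (K m)). lra.
    - intros m m' N. pose proof (B' m). pose proof (B' m'). destruct (KJ m m' N) as [N'|[E N']].
      + destruct (consecutive_separated _ _ el_consecutive (K m) (K m') N'); [left | right]; lra.
      + destruct SF as [_ [S _]]. unfold a', b'. rewrite <- E. pose proof (el_lt (K m)).
        destruct (S m m' N); [left | right]; apply mix_mono; auto.
    - intros t N. destruct (excluded_middle_informative (exists k, el k < val t < el (S k))) as [[k h]|h].
      + rewrite (proj1 PG k t h). pose proof (el_lt k) as Lk.
        apply FN. rewrite val_clampI by (apply ramp_bounds; lra).
        intros At. destruct (Cov k _ At) as [m [E Hm]]. apply (N m). unfold a', b'. rewrite E.
        rewrite <- (ramp_mix (el k) (el (S k)) (val t) Lk). unfold mix in *. nra.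
      + apply PG. eauto. }
  eapply homotopic_trans; [apply (prod_inf_pieces opn x Hcomm F a b); auto|].
  eapply homotopic_trans; [|apply homotopic_sym, (prod_inf_pieces opn x Hcomm G a' b'); auto].
  apply (prod_inf_small_homotopy opn x (fun m y => y = x \/ exists t, y = piece F a b m t)).
  { apply null_seq_sets, piece_null; auto. }
  intros m. pose proof (el_lt (K m)) as Lk.
  (* Piece m of [G] is piece m of [F] read through the affine coordinate of the slot, clamped
     outside it. *)
  apply (reparam_id opn _ x _ _ (fun t : I => val (clampI (ramp (el (K m)) (el (S (K m))) (val t))))).
  - apply is_loop_own_image, piece_loop; auto.
  - apply rcont_clamp, rcont_ramp; auto.
  - rewrite clampI_le0; auto. apply ramp_le0; auto. simpl. apply el_bounds.
  - rewrite clampI_ge1; auto. apply ramp_ge1; auto. simpl. left. apply el_bounds.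
  - intros t. rewrite clampI_val. set (r := ramp (el (K m)) (el (S (K m))) (val t)).
    pose proof (B m) as Bm. set (w := Rmin (Rmax r (a m)) (b m)).
    assert (Bw : a m <= w <= b m) by (unfold w; minmax).
    assert (E1 : Rmin (Rmax (val t) (a' m)) (b' m) = mix (el (K m)) (el (S (K m))) w).
    { unfold a', b'. rewrite <- (ramp_mix (el (K m)) (el (S (K m))) (val t) Lk).
      rewrite Rmax_mix, Rmin_mix by auto. auto. }
    assert (E2 : Rmin (Rmax (val (clampI r)) (a m)) (b m) = w) by (unfold w; simpl; minmax).
    pose proof (B' m) as Bm'. pose proof (el_within (K m)) as Wm.
    assert (Hmw : el (K m) <= mix (el (K m)) (el (S (K m))) w <= el (S (K m))) by (rewrite <- E1; minmax).
    unfold piece. rewrite E1, E2.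
    rewrite (placed_closed x Fk el (fun n => el (S n)) G el_within (consecutive_separated _ _ el_consecutive) Ends PG (K m)).
    2:{ rewrite val_clampI; lra. }
    rewrite val_clampI by lra.
    replace (ramp (el (K m)) (el (S (K m))) (mix (el (K m)) (el (S (K m))) w)) with w
      by (unfold ramp, mix; field; lra).
    destruct (Hab (K m)) as [_ [_ [_ [C [_ NE]]]]]. specialize (NE (J m)). fold (a m) (b m) in NE.
    (* Endpoints of a component lie outside [A (K m)], so both loops are at [x] there; inside,
       [Fk (K m)] agrees with [F]. *)
    destruct (Req_dec w (a m)) as [->|Na]; [|destruct (Req_dec w (b m)) as [->|Nb]].
    + rewrite (supported_left x F a b SF m). apply FN. rewrite val_clampI by lra. apply NE.
    + rewrite (supported_right x F a b SF m). apply FN. rewrite val_clampI by lra. apply NE.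
    + apply FA. rewrite val_clampI by lra. apply (C (J m)). fold (a m) (b m). lra.
Qed.

End Shuffle.

(** * Coordinates on the Hawaiian earring and on the torus *)

Lemma dR2_fst (p q : R * R) : Rabs (fst p - fst q) <= dR2 p q.
Proof.
  unfold dR2. rewrite <- sqrt_Rsqr_abs. apply sqrt_le_1_alt. unfold Rsqr.
  pose proof (pow2_ge_0 (snd p - snd q)). nra.
Qed.

Lemma dR2_snd (p q : R * R) : Rabs (snd p - snd q) <= dR2 p q.
Proof.
  unfold dR2. rewrite <- sqrt_Rsqr_abs. apply sqrt_le_1_alt. unfold Rsqr.
  pose proof (pow2_ge_0 (fst p - fst q)). nra.
Qed.

Lemma dR2_le_sum (p q : R * R) : dR2 p q <= Rabs (fst p - fst q) + Rabs (snd p - snd q).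
Proof.
  unfold dR2. pose proof (Rabs_pos (fst p - fst q)). pose proof (Rabs_pos (snd p - snd q)).
  rewrite <- (sqrt_Rsqr (Rabs (fst p - fst q) + _)) by lra. apply sqrt_le_1_alt.
  rewrite <- (pow2_abs (fst p - fst q)), <- (pow2_abs (snd p - snd q)). unfold Rsqr. nra.
Qed.

Section Coordinates.
Context {M : Type} {d : M -> M -> R}.

Lemma R2_pcont (c : M -> R * R) :
  rcont d (fun p => fst (c p)) -> rcont d (fun p => snd (c p)) -> pcont d R2_open c.
Proof.
  intros H K U HU p Up. destruct (HU _ Up) as [e [He L]].
  destruct (near_and d p _ _ (H p (e/2) ltac:(lra)) (K p (e/2) ltac:(lra))) as [f [Hf N]].
  exists f. split; auto. intros q Hq. apply L. destruct (N q Hq).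
  pose proof (dR2_le_sum (c p) (c q)). lra.
Qed.

Lemma pcont_R2 (c : M -> R * R) : pcont d R2_open c ->
  rcont d (fun p => fst (c p)) /\ rcont d (fun p => snd (c p)).
Proof.
  intros H. split; intros p e He.
  - destruct (H (fun q => Rabs (fst (c p) - fst q) < e)) with (a := p) as [f [Hf K]].
    + intros q Hq. exists (e - Rabs (fst (c p) - fst q)). split; [lra|]. intros r Hr.
      pose proof (dR2_fst q r).
      replace (fst (c p) - fst r) with ((fst (c p) - fst q) + (fst q - fst r)) by ring.
      eapply Rle_lt_trans; [apply Rabs_triang|]. lra.
    + rewrite Rminus_diag, Rabs_R0. auto.
    + exists f. split; auto.
  - destruct (H (fun q => Rabs (snd (c p) - snd q) < e)) with (a := p) as [f [Hf K]].
    + intros q Hq. exists (e - Rabs (snd (c p) - snd q)). split; [lra|]. intros r Hr.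
      pose proof (dR2_snd q r).
      replace (snd (c p) - snd r) with ((snd (c p) - snd q) + (snd q - snd r)) by ring.
      eapply Rle_lt_trans; [apply Rabs_triang|]. lra.
    + rewrite Rminus_diag, Rabs_R0. auto.
    + exists f. split; auto.
Qed.

Lemma T_pcont (u : M -> nat -> R * R) :
  (forall k, rcont d (fun p => fst (u p k)) /\ rcont d (fun p => snd (u p k))) -> pcont d T_open u.
Proof.
  intros H U HU p Up. destruct (HU _ Up) as [N [e [He L]]].
  destruct (near_finite d p (fun k q => dR2 (u p k) (u q k) < e) N) as [f [Hf K]].
  - intros k _. destruct (H k) as [H1 H2].
    destruct (near_and d p _ _ (H1 p (e/2) ltac:(lra)) (H2 p (e/2) ltac:(lra))) as [f [Hf K]].
    exists f. split; auto. intros q Hq. destruct (K q Hq).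
    pose proof (dR2_le_sum (u p k) (u q k)). lra.
  - exists f. split; auto.
Qed.

Lemma pcont_T (u : M -> nat -> R * R) : pcont d T_open u ->
  forall k, rcont d (fun p => fst (u p k)) /\ rcont d (fun p => snd (u p k)).
Proof.
  intros H k. apply (pcont_R2 (fun p => u p k)). intros U HU.
  apply (H (fun v => U (v k))). intros v Hv. destruct (HU _ Hv) as [e [He L]].
  exists (S k), e. split; auto.
Qed.

Lemma HE_comp {X : Type} (opn : (X -> Prop) -> Prop) (f : R * R -> X) (c : M -> R * R) :
  HE_map_cont opn f -> (forall p, inHE (c p)) ->
  rcont d (fun p => fst (c p)) -> rcont d (fun p => snd (c p)) ->
  pcont d opn (fun p => f (c p)).
Proof.
  intros Hf Hc H K U HU p Up. destruct (Hf U HU (c p) (Hc p) Up) as [e [He L]].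
  destruct (near_and d p _ _ (H p (e/2) ltac:(lra)) (K p (e/2) ltac:(lra))) as [g [Hg N]].
  exists g. split; auto. intros q Hq. apply L; auto. destruct (N q Hq).
  pose proof (dR2_le_sum (c p) (c q)). lra.
Qed.

End Coordinates.

Lemma INR_S_pos (k : nat) : 0 < INR (S k).
Proof. apply lt_0_INR. lia. Qed.

Lemma on_C_iff (k : nat) (p : R * R) :
  on_C (S k) p <-> INR (S k) * (fst p ^ 2 + snd p ^ 2) = 2 * fst p.
Proof.
  unfold on_C. pose proof (INR_S_pos k) as HK. set (K := INR (S k)) in *. clearbody K.
  assert (E : K * ((fst p - / K) ^ 2 + snd p ^ 2 - (/ K) ^ 2) = K * (fst p ^ 2 + snd p ^ 2) - 2 * fst p)
    by (field; lra).
  split; intros H.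
  - rewrite H, Rminus_diag in E. lra.
  - assert (Z : K * ((fst p - / K) ^ 2 + snd p ^ 2 - (/ K) ^ 2) = 0) by lra.
    apply Rmult_integral in Z. lra.
Qed.

Lemma inHE_iff (p : R * R) : inHE p <-> exists k, on_C (S k) p.
Proof.
  split.
  - intros [[|k] [Hn H]]; [lia|]. eauto.
  - intros [k H]. exists (S k). split; auto. lia.
Qed.

Lemma inHE_b0 : inHE b0.
Proof. apply inHE_iff. exists 0%nat. apply on_C_iff. simpl. ring. Qed.

Lemma sum_sqr_zero (p : R * R) : fst p ^ 2 + snd p ^ 2 = 0 -> p = b0.
Proof. intros H. destruct p as [u v]. simpl in *. unfold b0. f_equal; nra. Qed.

Lemma sum_sqr_pos (p : R * R) : p <> b0 -> 0 < fst p ^ 2 + snd p ^ 2.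
Proof.
  intros H. pose proof (pow2_ge_0 (fst p)). pose proof (pow2_ge_0 (snd p)).
  destruct (Req_dec (fst p ^ 2 + snd p ^ 2) 0) as [E|]; [|lra].
  exfalso. apply H, sum_sqr_zero; auto.
Qed.

(** Without the common point the circles are pairwise disjoint, and each is open in the earring. *)
Definition on_C' (k : nat) (p : R * R) : Prop := on_C (S k) p /\ p <> b0.

Lemma on_C'_unique (k l : nat) (p : R * R) : on_C' k p -> on_C' l p -> k = l.
Proof.
  intros [H N] [H' _]. rewrite on_C_iff in H, H'. apply sum_sqr_pos in N.
  assert (E : INR (S k) = INR (S l)) by nra. apply INR_eq in E. lia.
Qed.

Lemma HE_cases (p : R * R) : inHE p -> p = b0 \/ exists k, on_C' k p.
Proof.
  intros H. destruct (excluded_middle_informative (p = b0)); auto.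
  right. apply inHE_iff in H. destruct H as [k H]. exists k. split; auto.
Qed.

(* On the earring, [2 x / (x^2 + y^2)] takes the integer value [k + 1] on the circle of index [k]. *)
Lemma on_C'_open_form (k : nat) (p : R * R) : inHE p ->
  (on_C' k p <-> 2 * fst p < (INR (S k) + /2) * (fst p ^ 2 + snd p ^ 2) /\
                (INR (S k) - /2) * (fst p ^ 2 + snd p ^ 2) < 2 * fst p).
Proof.
  intros Hp. split.
  - intros [H N]. rewrite on_C_iff in H. apply sum_sqr_pos in N. nra.
  - intros [H1 H2].
    assert (N : p <> b0) by (intros ->; simpl in *; lra).
    destruct (HE_cases p Hp) as [|[l [Hl _]]]; [contradiction|].
    assert (k = l); [|subst; split; auto].
    rewrite on_C_iff in Hl. apply sum_sqr_pos in N.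
    assert (A1 : INR (S l) < INR (S k) + /2) by nra.
    assert (A2 : INR (S k) - /2 < INR (S l)) by nra.
    destruct (Nat.lt_trichotomy k l) as [L|[L|L]]; auto; exfalso;
     apply lt_INR in L; [assert (L' : INR (S k) + 1 <= INR (S l)) | assert (L' : INR (S l) + 1 <= INR (S k))]; try lra;
     rewrite <- S_INR; apply le_INR; apply INR_lt in L; lia.
Qed.

Lemma on_C'_near {M : Type} {d : M -> M -> R} (c : M -> R * R) (k : nat) (p : M) :
  (forall q, inHE (c q)) -> rcont d (fun p => fst (c p)) -> rcont d (fun p => snd (c p)) ->
  on_C' k (c p) -> exists e, 0 < e /\ forall q, d p q < e -> on_C' k (c q).
Proof.
  intros HE H1 H2 Hp. apply on_C'_open_form in Hp; auto. destruct Hp as [A B].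
  assert (H3 : rcont d (fun p => fst (c p) ^ 2 + snd (c p) ^ 2)).
  { simpl. auto 10 with rc. }
  destruct (near_and d p _ _ (near_lt _ _ p (rcont_scal 2 _ H1) (rcont_scal (INR (S k) + /2) _ H3) A)
     (near_lt _ _ p (rcont_scal (INR (S k) - /2) _ H3) (rcont_scal 2 _ H1) B)) as [e [He K]].
  exists e. split; auto. intros q Hq. apply on_C'_open_form; auto.
Qed.

(** Projection to the k-th circle factor, followed by the inverse of the similarity used in [eta];
    its values lie on the earring circle of radius 1/(k+1). *)
Definition rho (k : nat) (u : nat -> R * R) : R * R :=
  ((fst (u k) + 1) / INR (S k), snd (u k) / INR (S k)).

Lemma rho_on_C (k : nat) (u : nat -> R * R) : inT u -> on_C (S k) (rho k u).
Proof.
  intros H. specialize (H k). unfold on_S1 in H. apply on_C_iff.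
  pose proof (INR_S_pos k). unfold rho. cbn [fst snd].
  replace (INR (S k) * (((fst (u k) + 1) / INR (S k)) ^ 2 + (snd (u k) / INR (S k)) ^ 2))
    with ((fst (u k) ^ 2 + snd (u k) ^ 2 + 2 * fst (u k) + 1) / INR (S k)) by (field; lra).
  rewrite H. field. lra.
Qed.

Lemma rho_inHE (k : nat) (u : nat -> R * R) : inT u -> inHE (rho k u).
Proof. intros. apply inHE_iff. exists k. apply rho_on_C; auto. Qed.

Lemma rho_x0 (k : nat) : rho k x0 = b0.
Proof. unfold rho, x0, b0. simpl fst. simpl snd. pose proof (INR_S_pos k). f_equal; field; lra. Qed.

Lemma rho_eta_on (k : nat) (p : R * R) : on_C (S k) p -> rho k (eta p) = p.
Proof.
  intros H. unfold rho, eta. destruct Req_EM_T as [|N]; [|contradiction].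
  destruct p as [u v]. cbn [fst snd]. pose proof (INR_S_pos k). f_equal; field; lra.
Qed.

Lemma rho_eta_off (k : nat) (p : R * R) : inHE p -> ~ on_C' k p -> rho k (eta p) = b0.
Proof.
  intros Hp N. destruct (excluded_middle_informative (on_C (S k) p)) as [h|h].
  - rewrite rho_eta_on by auto. destruct (excluded_middle_informative (p = b0)); auto.
    exfalso. apply N. split; auto.
  - unfold rho, eta. destruct Req_EM_T as [h'|_]; [contradiction|].
    cbn [fst snd]. unfold b0. pose proof (INR_S_pos k). f_equal; field; lra.
Qed.

Lemma eta_inT (p : R * R) : inT (eta p).
Proof.
  intros k. unfold on_S1, eta. destruct Req_EM_T as [h|h]; cbn [fst snd]; [|ring].
  change (on_C (S k) p) in h. rewrite on_C_iff in h.
  replace ((INR (S k) * fst p - 1) ^ 2 + (INR (S k) * snd p) ^ 2)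
   with (INR (S k) * (INR (S k) * (fst p ^ 2 + snd p ^ 2)) - INR (S k) * (2 * fst p) + 1) by ring.
  rewrite h. ring.
Qed.

Lemma rho_small (k : nat) (u : nat -> R * R) : inT u -> dR2 b0 (rho k u) <= 3 / INR (S k).
Proof.
  intros H. specialize (H k). unfold on_S1 in H. pose proof (INR_S_pos k) as HK.
  assert (B : -1 <= fst (u k) <= 1) by nra. assert (B' : -1 <= snd (u k) <= 1) by nra.
  assert (Ki : 0 < / INR (S k)) by (apply Rinv_0_lt_compat; auto).
  eapply Rle_trans; [apply dR2_le_sum|]. unfold b0, rho. cbn [fst snd]. unfold Rdiv.
  (* The first coordinate contributes at most 2/(k+1), the second at most 1/(k+1); hence the
     constant 3. *)
  assert (A1 : Rabs (0 - (fst (u k) + 1) * / INR (S k)) <= 2 * / INR (S k)) by (apply Rabs_le; nra).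
  assert (A2 : Rabs (0 - snd (u k) * / INR (S k)) <= / INR (S k)) by (apply Rabs_le; nra).
  lra.
Qed.

(** * The homomorphism defined on loops of the torus *)

Section Factor.
Context {X : Type} (opn : (X -> Prop) -> Prop) (x : X) (f : R * R -> X).
Context (Hf : HE_map_cont opn f) (Hx : f b0 = x).

Local Notation all := (fun _ : X => True).
Local Notation "g =~ h" := (homotopic opn all x g h) (at level 70).

(** Circles of large index lie near [b0], uniformly in the point of [M]. The general [M] covers
    loops and homotopies alike. *)
Lemma rho_null {M : Type} (u : M -> nat -> R * R) : (forall p, inT (u p)) ->
  null_fam opn x (fun k p => f (rho k (u p))).
Proof.
  intros Hu U HU Ux. rewrite <- Hx in Ux. destruct (Hf U HU b0 inHE_b0 Ux) as [e [He K]].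
  destruct (archimed_cor1 (e / 3)) as [N [HN HN0]]; [lra|].
  exists N. intros n Hn p. apply K; [apply rho_inHE; auto|].
  eapply Rle_lt_trans; [apply rho_small; auto|].
  assert (0 < INR N) by (apply lt_0_INR; lia).
  assert (INR N <= INR (S n)) by (apply le_INR; lia).
  assert (/ INR (S n) <= / INR N) by (apply Rinv_le_contravar; lra). unfold Rdiv. lra.
Qed.

Lemma rho_pcont {M : Type} (d : M -> M -> R) (u : M -> nat -> R * R) (k : nat) :
  (forall p, inT (u p)) -> pcont d T_open u -> pcont d opn (fun p => f (rho k (u p))).
Proof.
  intros Hu Hc. destruct (pcont_T u Hc k) as [C1 C2].
  apply (HE_comp opn f (fun p => rho k (u p))); auto.
  - intros; apply rho_inHE; auto.
  - unfold rho. cbn [fst]. unfold Rdiv. auto with rc.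
  - unfold rho. cbn [snd]. unfold Rdiv. auto with rc.
Qed.

Definition coordinate_product (a : I -> nat -> R * R) : I -> X :=
  prod_inf x (fun k t => f (rho k (a t))).

Lemma rho_null_seq (a : I -> nat -> R * R) : is_loop T_open inT x0 a ->
  null_seq opn x (fun k t => f (rho k (a t))).
Proof.
  intros [Ha [Hc [E0 E1]]]. split.
  - intros k. split; [|split; [|split]]; auto.
    + apply (rho_pcont dI a k); auto.
    + rewrite E0, rho_x0. auto.
    + rewrite E1, rho_x0. auto.
  - apply (rho_null a); auto.
Qed.

(** A homotopy in the torus gives one homotopy in each circle; these form a null family and run side
    by side in their slots. *)
Lemma coordinate_product_homotopic (a b : I -> nat -> R * R) :
  homotopic T_open inT x0 a b -> coordinate_product a =~ coordinate_product b.
Proof.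
  intros [H [HT [Hc [H0 [H1 He]]]]].
  apply (homotopic_placed opn x (fun k p => f (rho k (H p)))
    el (fun n => el (S n)) el (fun n => el (S n))); auto using el_within, el_consecutive, consecutive_same_order.
  - intros k. apply (rho_pcont dII H k); auto.
  - intros k s. destruct (He s) as [-> ->]. rewrite rho_x0. auto.
  - apply (rho_null H); auto.
  - replace (fun n t => f (rho n (H (t, I0)))) with (fun n t => f (rho n (a t))).
    + apply prod_inf_placed. intros n. rewrite <- H0. destruct (He I0) as [-> _]. rewrite rho_x0. auto.
    + extensionality n. extensionality t. rewrite H0. auto.
  - replace (fun n t => f (rho n (H (t, I1)))) with (fun n t => f (rho n (b t))).
    + apply prod_inf_placed. intros n. rewrite <- H1. destruct (He I1) as [-> _]. rewrite rho_x0. auto.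
    + extensionality n. extensionality t. rewrite H1. auto.
Qed.

Context (Hcomm : inf_comm opn x).

(** Both sides have the factors [a_k] and [b_k]. The left one alternates them in order type omega,
    the right one has order type omega + omega, so [placed_prod_inf] has to bring the right one into
    the first form. *)
Lemma coordinate_product_concat (a b : I -> nat -> R * R) :
  is_loop T_open inT x0 a -> is_loop T_open inT x0 b ->
  coordinate_product (concat a b) =~ concat (coordinate_product a) (coordinate_product b).
Proof.
  intros La Lb. pose proof (rho_null_seq a La) as Na. pose proof (rho_null_seq b Lb) as Nb.
  unfold coordinate_product.
  replace (fun k t => f (rho k (concat a b t))) with
    (fun k => concat (fun t => f (rho k (a t))) (fun t => f (rho k (b t)))).
  2:{ extensionality k. extensionality t. unfold concat. destruct Rle_dec; auto. }
  eapply homotopic_trans; [apply prod_inf_interleave; auto|].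
  apply homotopic_sym.
  eapply (placed_prod_inf opn x Hcomm); [| |apply null_seq_interleave; auto|].
  3:{ apply placed_concat with (a := el) (b := fun n => el (S n)) (a' := el) (b' := fun n => el (S n)).
      - apply el_within.
      - apply el_within.
      - apply prod_inf_loop in Na. apply Na.
      - apply prod_inf_placed. intros n. apply (loop_endpoints opn x _ Na).
      - apply prod_inf_placed. intros n. apply (loop_endpoints opn x _ Nb). }
  - intros k. destruct (even_or_odd k) as [n [->| ->]]; rewrite ?interleave_even, ?interleave_odd;
     pose proof (el_within n); lra.
  - intros i j N. destruct (even_or_odd i) as [n [->| ->]], (even_or_odd j) as [m [->| ->]];
     rewrite ?interleave_even, ?interleave_odd; pose proof (el_within n); pose proof (el_within m); try lra;
     (destruct (consecutive_separated _ _ el_consecutive n m ltac:(lia)); lra).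
Qed.

Lemma coordinate_product_eta (c : I -> R * R) : is_loop R2_open inHE b0 c ->
  (fun t => f (c t)) =~ coordinate_product (fun t => eta (c t)).
Proof.
  intros [Hc [Cc [E0 E1]]]. destruct (pcont_R2 c Cc) as [C1 C2].
  assert (Hfc : pcont dI opn (fun t => f (c t))) by (apply HE_comp; auto).
  assert (Off : forall k t, ~ on_C' k (c t) -> f (rho k (eta (c t))) = x).
  { intros. rewrite rho_eta_off; auto. }
  assert (On : forall k t, on_C' k (c t) -> f (rho k (eta (c t))) = f (c t)).
  { intros k t [H _]. rewrite rho_eta_on; auto. }
  assert (None : forall t, (forall k, ~ on_C' k (c t)) -> f (c t) = x).
  { intros t H. destruct (HE_cases (c t) (Hc t)) as [->|[k Hk]]; auto. exfalso; eapply H; eauto. }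
  assert (NS : null_seq opn x (fun k t => f (rho k (eta (c t))))).
  { split; [|apply (rho_null (fun t => eta (c t))); intros; apply eta_inT].
    intros k. split; [|split; [|split]]; auto.
    - apply (glue_cont_local opn x (fun j t => on_C' j (c t))
        (fun j t => if Nat.eqb j k then f (c t) else x)).
      + intros j t. apply on_C'_near; auto.
      + intros j t Hj. destruct (Nat.eqb_spec j k) as [->|N]; auto.
        apply Off. intros Hk. apply N, (on_C'_unique _ _ _ Hj Hk).
      + auto.
      + intros j U t HU Ut Hj. destruct (Nat.eqb_spec j k) as [->|N].
        * destruct (Hfc U HU t) as [e [He K]].
          { destruct Hj as [Hj|Hj]; [rewrite <- (On k) | rewrite None, <- (Off k t)]; auto. }
          exists e. split; auto.
        * exists 1. split; [lra|]. intros _ _ _. rewrite <- (Off k t); auto.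
          destruct Hj as [Hj|Hj]; auto. intros Hk. apply N, (on_C'_unique _ _ _ Hj Hk).
      + intros U HU Ux. exists (S k). intros n Hn t _. destruct (Nat.eqb_spec n k); auto. lia.
    - apply Off. rewrite E0. intros [_ H]. auto.
    - apply Off. rewrite E1. intros [_ H]. auto. }
  apply (prod_inf_shuffle opn x Hcomm (fun k s => 0 <= s <= 1 /\ on_C' k (c (clampI s)))); auto.
  - intros k s [Hs H].
    assert (Hs' : 0 < s < 1).
    { destruct (Req_dec s 0) as [->|N0]; [|destruct (Req_dec s 1) as [->|N1]]; [| |lra]; exfalso.
      - rewrite clampI_le0, E0 in H by lra. apply (proj2 H). auto.
      - rewrite clampI_ge1, E1 in H by lra. apply (proj2 H). auto. }
    destruct (on_C'_near c k (clampI s) Hc C1 C2 H) as [e [He K]].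
    (* The bound [Rmin s (1 - s)] keeps [r] in [0,1]. *)
    exists (Rmin e (Rmin s (1 - s))). split; [minmax|]. intros r Hr.
    assert (Hr' : Rabs (s - r) < e) by (eapply Rlt_le_trans; [exact Hr | apply Rmin_l]).
    assert (Hr2 : Rabs (s - r) < Rmin s (1 - s)) by (eapply Rlt_le_trans; [exact Hr | apply Rmin_r]).
    pose proof (Rmin_l s (1 - s)). pose proof (Rmin_r s (1 - s)). apply Rabs_def2 in Hr2.
    split; [lra|]. apply K. unfold dI. eapply Rle_lt_trans; [apply clampI_lip | auto].
  - intros k s [Hs H].
    destruct (Req_dec s 0) as [->|N0]; [|destruct (Req_dec s 1) as [->|N1]]; [| |lra]; exfalso.
    + rewrite clampI_le0, E0 in H by lra. apply (proj2 H). auto.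
    + rewrite clampI_ge1, E1 in H by lra. apply (proj2 H). auto.
  - intros k l s [_ H] [_ H']. eapply on_C'_unique; eauto.
  - split; [|split; [|split]]; auto; [rewrite E0 | rewrite E1]; auto.
  - intros k t [_ H]. rewrite clampI_val in H. auto.
  - intros k t N. apply Off. intros H. apply N. rewrite clampI_val. split; auto. apply I_bounds.
  - intros t N. apply None. intros k H. apply (N k). rewrite clampI_val. split; auto. apply I_bounds.
Qed.

End Factor.

Theorem factor_of_inf_comm {X : Type} (opn : (X -> Prop) -> Prop) (x : X) :
  inf_comm opn x -> cond_factor opn x.
Proof.
  intros Hcomm f Hf Hx. exists (coordinate_product x f).
  split; [|split; [|split]].
  - intros a La. apply prod_inf_loop, rho_null_seq; auto.
  - intros a b _ _. apply coordinate_product_homotopic; auto.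
  - intros a b. apply coordinate_product_concat; auto.
  - intros c. apply coordinate_product_eta; auto.
Qed.

(** * Factoring through the torus makes products independent of the placement *)

(* A loop around the unit circle based at (-1, 0), linear in the first coordinate on each half. *)
Definition circ (t : R) : R * R :=
  (4 * Rmin t (1 - t) - 1,
   sqrt (8 * ((1 - t) * Rmax 0 (2 * t - 1))) - sqrt (8 * (t * Rmax 0 (1 - 2 * t)))).

Lemma circ_half_l (t : R) : 0 <= t <= 1/2 -> circ t = (4 * t - 1, - sqrt (8 * (t * (1 - 2 * t)))).
Proof.
  intros. unfold circ. rewrite Rmin_left, Rmax_left, Rmax_right by lra.
  f_equal. rewrite !Rmult_0_r, sqrt_0. ring.
Qed.

Lemma circ_half_r (t : R) : 1/2 <= t <= 1 ->
  circ t = (4 * (1 - t) - 1, sqrt (8 * ((1 - t) * (2 * t - 1)))).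
Proof.
  intros. unfold circ. rewrite Rmin_right, Rmax_right, Rmax_left by lra.
  f_equal. rewrite !Rmult_0_r, sqrt_0. ring.
Qed.

Lemma circ_0 : circ 0 = (-1, 0).
Proof. rewrite circ_half_l by lra. replace (8 * _) with 0 by ring. rewrite sqrt_0. f_equal; ring. Qed.

Lemma circ_1 : circ 1 = (-1, 0).
Proof.
  rewrite circ_half_r by lra. replace (8 * _) with 0 by ring. rewrite sqrt_0. f_equal; ring.
Qed.

(** The radicand is forced: [1 - (4 t - 1)^2 = 8 t (1 - 2 t)]. The lower half comes first, so the
    loop is counterclockwise. *)
Lemma circ_on_S1 (t : R) : 0 <= t <= 1 -> on_S1 (circ t).
Proof.
  intros Ht. unfold on_S1. destruct (Rle_dec t (1/2)).
  - rewrite circ_half_l by lra. cbn [fst snd].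
    replace ((- sqrt (8 * (t * (1 - 2 * t)))) ^ 2) with (sqrt (8 * (t * (1 - 2 * t))) ^ 2) by ring.
    rewrite pow2_sqrt by nra. ring.
  - rewrite circ_half_r by lra. cbn [fst snd]. rewrite pow2_sqrt by nra. ring.
Qed.

Lemma rcont_circ {M : Type} {d : M -> M -> R} (phi : M -> R) :
  rcont d phi -> (forall p, 0 <= phi p <= 1) ->
  rcont d (fun p => fst (circ (phi p))) /\ rcont d (fun p => snd (circ (phi p))).
Proof.
  intros H B. unfold circ. cbn [fst snd]. split; [auto 10 with rc|].
  apply rcont_minus; apply rcont_sqrt; auto 10 with rc; intros p; specialize (B p).
  - pose proof (Rmax_l 0 (2 * phi p - 1)). apply Rmult_le_pos; [lra|]. apply Rmult_le_pos; lra.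
  - pose proof (Rmax_l 0 (1 - 2 * phi p)). apply Rmult_le_pos; [lra|]. apply Rmult_le_pos; lra.
Qed.

(** [rho k] reads only coordinate [k], so a constant sequence is a sufficient argument. The circle
    of index [k] has radius 1/(k+1). *)
Definition ell (k : nat) : I -> R * R := fun t => rho k (fun _ => circ (val t)).

Lemma ell_on_C (k : nat) (t : I) : on_C (S k) (ell k t).
Proof. apply rho_on_C. intros j. apply circ_on_S1, I_bounds. Qed.

Lemma ell_inHE (k : nat) (t : I) : inHE (ell k t).
Proof. apply inHE_iff. exists k. apply ell_on_C. Qed.

Lemma rho_base (k : nat) (u : nat -> R * R) : u k = (-1, 0) -> rho k u = b0.
Proof.
  intros E. unfold rho, b0. rewrite E. cbn [fst snd]. pose proof (INR_S_pos k). f_equal; field; lra.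
Qed.

Lemma ell_null_seq : null_seq R2_open b0 ell.
Proof.
  split.
  - intros k. split; [|split; [|split]]; auto.
    + destruct (rcont_circ (fun t : I => val t) rcont_val I_bounds) as [C1 C2].
      apply (R2_pcont (ell k)); unfold ell, rho; cbn [fst snd]; unfold Rdiv; auto with rc.
    + apply rho_base, circ_0.
    + apply rho_base, circ_1.
  - intros U HU Ub. destruct (HU b0 Ub) as [e [He K]].
    destruct (archimed_cor1 (e / 3)) as [N [HN HN0]]; [lra|].
    exists N. intros n Hn t. apply K.
    eapply Rle_lt_trans; [apply rho_small; intros j; apply circ_on_S1, I_bounds|].
    assert (0 < INR N) by (apply lt_0_INR; lia).
    assert (INR N <= INR (S n)) by (apply le_INR; lia).
    assert (/ INR (S n) <= / INR N) by (apply Rinv_le_contravar; lra). unfold Rdiv. lra.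
Qed.

Lemma eta_on (k : nat) (p : R * R) : on_C (S k) p ->
  eta p k = (INR (S k) * fst p - 1, INR (S k) * snd p).
Proof. intros H. unfold eta. destruct Req_EM_T as [|N]; [auto | contradiction]. Qed.

Lemma eta_off (k : nat) (p : R * R) : ~ on_C' k p -> eta p k = (-1, 0).
Proof.
  intros N. unfold eta. destruct Req_EM_T as [h|]; auto.
  destruct (excluded_middle_informative (p = b0)) as [->|n].
  - unfold b0. cbn [fst snd]. f_equal; ring.
  - exfalso. apply N. split; auto.
Qed.

Lemma eta_ell (k : nat) (t : I) : eta (ell k t) k = circ (val t).
Proof.
  rewrite eta_on by apply ell_on_C. unfold ell, rho. cbn [fst snd].
  pose proof (INR_S_pos k). destruct (circ (val t)) as [u v]. cbn [fst snd]. f_equal; field; lra.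
Qed.

Lemma eta_ell_other (k j : nat) (t : I) : j <> k -> eta (ell j t) k = (-1, 0).
Proof.
  intros N. apply eta_off. intros [H Hb]. apply N, (on_C'_unique _ _ (ell j t)); split; auto using ell_on_C.
Qed.

(** * Placed products, and the map of the earring given by a null sequence *)

Section Place.
Context {X : Type} (x : X).

Definition place (alpha : nat -> I -> X) (a b : nat -> R) : I -> X := fun t =>
  match excluded_middle_informative (exists n, a n < val t < b n) with
  | left h => let n := proj1_sig (constructive_indefinite_description _ h) in
      alpha n (clampI (ramp (a n) (b n) (val t)))
  | right _ => x
  end.

Lemma place_placed (alpha : nat -> I -> X) (a b : nat -> R) :
  separated a b -> placed x alpha a b (place alpha a b).
Proof.
  intros O. split.
  - intros n t Ht. unfold place. destruct excluded_middle_informative as [h|h]; [|exfalso; eauto].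
    destruct constructive_indefinite_description as [m Hm]. cbn.
    destruct (Nat.eq_dec n m) as [->|N]; auto. exfalso. destruct (O n m N); lra.
  - intros t N. unfold place. destruct excluded_middle_informative as [[n h]|h]; auto. exfalso; eapply N; eauto.
Qed.

(* The inverse of [ell k] on the circle of index [k], followed by [alpha k]. *)
Definition HE_branch (alpha : nat -> I -> X) (k : nat) (q : R * R) : X :=
  alpha k (clampI (if Rle_dec (snd q) 0 then INR (S k) * fst q / 4 else 1 - INR (S k) * fst q / 4)).

Definition HE_map (alpha : nat -> I -> X) (q : R * R) : X :=
  match excluded_middle_informative (exists k, on_C' k q) with
  | left h => HE_branch alpha (proj1_sig (constructive_indefinite_description _ h)) q
  | right _ => x
  end.

Context (alpha : nat -> I -> X).

Lemma HE_map_on (k : nat) (q : R * R) : on_C' k q -> HE_map alpha q = HE_branch alpha k q.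
Proof.
  intros H. unfold HE_map. destruct excluded_middle_informative as [h|h]; [|exfalso; eauto].
  destruct constructive_indefinite_description as [m Hm]. cbn. rewrite (on_C'_unique k m q); auto.
Qed.

Lemma HE_map_off (q : R * R) : (forall k, ~ on_C' k q) -> HE_map alpha q = x.
Proof.
  intros H. unfold HE_map. destruct excluded_middle_informative as [[k h]|h]; auto. exfalso; eapply H; eauto.
Qed.

Lemma HE_map_b0 : HE_map alpha b0 = x.
Proof. apply HE_map_off. intros k [_ H]. auto. Qed.

(** On the two halves of [ell k] the first coordinate is [4 t / (k+1)] and [4 (1 - t) / (k+1)],
    which [HE_branch] solves for [t]. The base point is met only at the two ends, where [alpha k] is
    at [x]. *)
Lemma HE_map_ell (k : nat) (t : I) : alpha k I0 = x -> alpha k I1 = x ->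
  HE_map alpha (ell k t) = alpha k t.
Proof.
  intros E0 E1. pose proof (I_bounds t) as Bt. pose proof (INR_S_pos k).
  destruct (excluded_middle_informative (ell k t = b0)) as [e|e].
  - rewrite e, HE_map_b0.
    assert (Em : circ (val t) = (-1, 0)).
    { rewrite <- (eta_ell k t), e. apply eta_off. intros [_ N]; auto. }
    destruct (Rle_dec (val t) (1/2)).
    + rewrite circ_half_l in Em by lra. injection Em; intros _ E.
      replace t with I0; auto. apply I_eq. simpl. lra.
    + rewrite circ_half_r in Em by lra. injection Em; intros _ E.
      replace t with I1; auto. apply I_eq. simpl. lra.
  - rewrite (HE_map_on k) by (split; auto using ell_on_C). unfold HE_branch. f_equal.
    transitivity (clampI (val t)); [|apply clampI_val]. f_equal.
    unfold ell, rho. cbn [fst snd].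
    assert (Ki : 0 < / INR (S k)) by (apply Rinv_0_lt_compat; auto).
    destruct (Rle_dec (val t) (1/2)).
    + rewrite circ_half_l by lra. cbn [fst snd].
      pose proof (sqrt_pos (8 * (val t * (1 - 2 * val t)))).
      destruct Rle_dec as [|n]; [field; lra|]. exfalso. apply n. unfold Rdiv. nra.
    + assert (val t < 1).
      { destruct (Req_dec (val t) 1) as [E|]; [|lra]. exfalso. apply e.
        apply rho_base. rewrite E. apply circ_1. }
      rewrite circ_half_r by lra. cbn [fst snd].
      assert (0 < sqrt (8 * ((1 - val t) * (2 * val t - 1)))) by (apply sqrt_lt_R0; nra).
      destruct Rle_dec as [l|]; [|field; lra]. exfalso. unfold Rdiv in l. nra.
Qed.

Lemma HE_map_continuous (opn : (X -> Prop) -> Prop) : null_seq opn x alpha -> HE_map_cont opn (HE_map alpha).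
Proof.
  intros [HL Hn].
  (* Gluing is done on the earring as a space of its own, since the punctured circles are open there
     and not in the plane. *)
  set (M := {q : R * R | inHE q}). set (d := fun p q : M => dR2 (proj1_sig p) (proj1_sig q)).
  assert (C1 : rcont d (fun q : M => fst (proj1_sig q))).
  { intros p e He. exists e. split; auto. intros q Hq. eapply Rle_lt_trans; [apply dR2_fst | exact Hq]. }
  assert (C2 : rcont d (fun q : M => snd (proj1_sig q))).
  { intros p e He. exists e. split; auto. intros q Hq. eapply Rle_lt_trans; [apply dR2_snd | exact Hq]. }
  assert (H : pcont d opn (fun q : M => HE_map alpha (proj1_sig q))).
  { apply (glue_cont_local opn x (fun k (q : M) => on_C' k (proj1_sig q))
      (fun k (q : M) => HE_branch alpha k (proj1_sig q))).
    - intros k p. apply on_C'_near; auto. intros q. exact (proj2_sig q).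
    - intros k p Hp. apply HE_map_on; auto.
    - intros p. apply HE_map_off.
    - intros k U p HU Up Hp.
      (* The formulas for the lower and the upper half. They meet where the second coordinate is 0:
         at the far point both have parameter 1/2, and at [b0] they are the two ends of
         [alpha k]. *)
      set (G1 := fun q : M => alpha k (clampI (INR (S k) * fst (proj1_sig q) * /4))).
      set (G2 := fun q : M => alpha k (clampI (1 - INR (S k) * fst (proj1_sig q) * /4))).
      assert (H1 : pcont d opn G1) by (apply pcont_clamp; auto with rc; exact (proj1 (proj2 (HL k)))).
      assert (H2 : pcont d opn G2) by (apply pcont_clamp; auto 10 with rc; exact (proj1 (proj2 (HL k)))).
      destruct (HL k) as [_ [_ [E0 E1]]].
      assert (Both : U (G1 p) -> U (G2 p) -> exists e, 0 < e /\
        forall q, d p q < e -> on_C' k (proj1_sig q) -> U (HE_branch alpha k (proj1_sig q))).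
      { intros U1 U2. destruct (near_and d p _ _ (H1 U HU p U1) (H2 U HU p U2)) as [e [He K]].
        exists e. split; auto. intros q Hq _. unfold HE_branch. destruct Rle_dec; apply (K q Hq). }
      destruct Hp as [Hp|Hp].
      + rewrite (HE_map_on k) in Up by auto. unfold HE_branch in Up.
        destruct (Rtotal_order (snd (proj1_sig p)) 0) as [L|[L|L]].
        * destruct (Rle_dec (snd (proj1_sig p)) 0); [|exfalso; lra].
          destruct (near_and d p _ _ (H1 U HU p Up) (near_lt _ _ p C2 (rcont_const 0) L)) as [e [He K]].
          exists e. split; auto. intros q Hq _. destruct (K q Hq) as [K1 K2]. unfold HE_branch.
          destruct Rle_dec; [exact K1 | exfalso; lra].
        * destruct (Rle_dec (snd (proj1_sig p)) 0); [|exfalso; lra].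
          apply Both; auto. unfold G2.
          assert (E : INR (S k) * fst (proj1_sig p) = 2).
          { destruct Hp as [Hp N]. rewrite on_C_iff, L in Hp.
            assert (fst (proj1_sig p) <> 0).
            { intros Z. apply N, sum_sqr_zero. rewrite L, Z. ring. }
            apply Rmult_eq_reg_r with (fst (proj1_sig p)); auto. rewrite <- Hp. ring. }
          replace (1 - INR (S k) * fst (proj1_sig p) * / 4) with (INR (S k) * fst (proj1_sig p) / 4) by lra.
          auto.
        * destruct (Rle_dec (snd (proj1_sig p)) 0); [exfalso; lra|].
          destruct (near_and d p _ _ (H2 U HU p Up) (near_lt _ _ p (rcont_const 0) C2 L)) as [e [He K]].
          exists e. split; auto. intros q Hq _. destruct (K q Hq) as [K1 K2]. unfold HE_branch.
          destruct Rle_dec; [exfalso; lra | exact K1].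
      + rewrite HE_map_off in Up by auto.
        assert (Eb : proj1_sig p = b0).
        { destruct (HE_cases _ (proj2_sig p)) as [|[j Hj]]; auto. exfalso; eapply Hp; eauto. }
        apply Both; unfold G1, G2; rewrite Eb; simpl fst.
        * rewrite clampI_le0 by lra. rewrite E0. auto.
        * rewrite clampI_ge1 by lra. rewrite E1. auto.
    - intros U HU Ux. destruct (Hn U HU Ux) as [N HN]. exists N. intros. apply HN; auto. }
  intros U HU p Hp Up. destruct (H U HU (exist _ p Hp) Up) as [e [He K]].
  exists e. split; auto. intros q Hq Hpq. apply (K (exist _ q Hq)). auto.
Qed.

End Place.

(** Coordinate [k] ignores the loops around the other circles, so it depends on interval [k] alone.
    This is how the torus forgets the order of the factors. *)
Lemma eta_placed (a b : nat -> R) (t : I) (k : nat) : within a b -> separated a b ->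
  eta (place b0 ell a b t) k = circ (val (clampI (ramp (a k) (b k) (val t)))).
Proof.
  intros W O. destruct (place_placed b0 ell a b O) as [P1 P2].
  destruct (excluded_middle_informative (a k < val t < b k)) as [h|h].
  - rewrite (P1 k) by auto. apply eta_ell.
  - replace (circ _) with (-1, 0).
    + destruct (excluded_middle_informative (exists n, a n < val t < b n)) as [[n h']|h'].
      * rewrite (P1 n) by auto. apply eta_ell_other. intros ->; auto.
      * rewrite P2 by eauto. apply eta_off. intros [_ N]; auto.
    + destruct (Rle_dec (val t) (a k)).
      * rewrite clampI_le0 by (apply ramp_le0; [apply W|auto]). symmetry. apply circ_0.
      * rewrite clampI_ge1 by (apply ramp_ge1; [apply W|lra]). symmetry. apply circ_1.
Qed.

(** In each coordinate the two parameters are joined by straight lines. Continuity in the product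
    topology is tested coordinatewise, so nothing need shrink and intervals may cross. *)
Lemma eta_placed_homotopic (a b a' b' : nat -> R) :
  within a b -> separated a b -> within a' b' -> separated a' b' ->
  homotopic T_open inT x0 (fun t => eta (place b0 ell a b t)) (fun t => eta (place b0 ell a' b' t)).
Proof.
  intros W O W' O'.
  set (u := fun k (t : I) => val (clampI (ramp (a k) (b k) (val t)))).
  set (u' := fun k (t : I) => val (clampI (ramp (a' k) (b' k) (val t)))).
  assert (B : forall k p, 0 <= mix (u k (fst p)) (u' k (fst p)) (val2 p) <= 1).
  { intros k p. pose proof (I_bounds (clampI (ramp (a k) (b k) (val1 p)))) as B1.
    pose proof (I_bounds (clampI (ramp (a' k) (b' k) (val1 p)))) as B2.
    fold (u k (fst p)) in B1. fold (u' k (fst p)) in B2. pose proof (I_bounds (snd p)).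
    unfold mix. nra. }
  exists (fun p k => circ (mix (u k (fst p)) (u' k (fst p)) (val2 p))).
  split; [|split; [|split; [|split]]].
  - intros p k. apply circ_on_S1. apply B.
  - apply (T_pcont (fun (p : I * I) k => circ (mix (u k (fst p)) (u' k (fst p)) (val2 p)))).
    intros k. apply rcont_circ; [|apply B].
    assert (Hu : rcont dI (u k)) by (apply rcont_clamp, rcont_ramp, W).
    assert (Hu' : rcont dI (u' k)) by (apply rcont_clamp, rcont_ramp, W').
    unfold mix. auto 10 with rc.
  - intros s. extensionality k. rewrite eta_placed by auto. fold (u k s). unfold mix. simpl.
    f_equal. ring.
  - intros s. extensionality k. rewrite eta_placed by auto. fold (u' k s). unfold mix. simpl.
    f_equal. ring.
  - assert (U0 : forall k, u k I0 = 0 /\ u' k I0 = 0).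
    { intros k. unfold u, u'. rewrite !clampI_le0; auto; apply ramp_le0; try apply W; try apply W'. }
    assert (U1 : forall k, u k I1 = 1 /\ u' k I1 = 1).
    { intros k. unfold u, u'. rewrite !clampI_ge1; auto; apply ramp_ge1; try apply W; try apply W'. }
    intros t. split; extensionality k; cbn [fst snd].
    + destruct (U0 k) as [-> ->]. unfold mix, x0. rewrite <- circ_0. f_equal. ring.
    + destruct (U1 k) as [-> ->]. unfold mix, x0. rewrite <- circ_1. f_equal. ring.
Qed.

Lemma place_loop (a b : nat -> R) : within a b -> separated a b ->
  is_loop R2_open inHE b0 (place b0 ell a b).
Proof.
  intros W O. apply is_loop_subset with (S := fun _ => True).
  - intros t. destruct (place_placed b0 ell a b O) as [P1 P2].
    destruct (excluded_middle_informative (exists n, a n < val t < b n)) as [[n h]|h].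
    + rewrite (P1 n) by auto. apply ell_inHE.
    + rewrite P2 by eauto. apply inHE_b0.
  - apply (loop_placed R2_open b0 ell a b); auto using ell_null_seq, place_placed.
Qed.

(** Both products are the images, under one map of the earring, of the loops [ell] placed along the
    two families. After [eta] these become homotopic, and [g] carries the homotopy to [X]. *)
Theorem placed_homotopic_of_factor {X : Type} (opn : (X -> Prop) -> Prop) (x : X)
  (alpha : nat -> I -> X) (a b a' b' : nat -> R) (P P' : I -> X) :
  cond_factor opn x -> null_seq opn x alpha ->
  within a b -> separated a b -> within a' b' -> separated a' b' ->
  placed x alpha a b P -> placed x alpha a' b' P' ->
  homotopic opn (fun _ => True) x P P'.
Proof.
  intros HC Ha W O W' O' HP HP'.
  destruct (HC (HE_map x alpha)) as [g [_ [G2 [_ G4]]]].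
  { apply HE_map_continuous; auto. }
  { apply HE_map_b0. }
  pose proof (loop_endpoints opn x alpha Ha) as HE.
  assert (Key : forall c d Q, within c d -> separated c d -> placed x alpha c d Q ->
    Q = (fun t => HE_map x alpha (place b0 ell c d t))).
  { intros c d Q Wc Oc [Q1 Q2]. extensionality t. destruct (place_placed b0 ell c d Oc) as [P1 P2].
    destruct (excluded_middle_informative (exists n, c n < val t < d n)) as [[n h]|h].
    - rewrite (P1 n), (Q1 n) by auto. symmetry. apply HE_map_ell; apply HE.
    - rewrite P2, Q2 by eauto. symmetry. apply HE_map_b0. }
  rewrite (Key a b P), (Key a' b' P') by auto.
  pose proof (eta_placed_homotopic a b a' b' W O W' O') as HT.
  eapply homotopic_trans; [apply G4, place_loop; auto|].
  eapply homotopic_trans; [|apply homotopic_sym, G4, place_loop; auto].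
  apply G2; auto; [eapply homotopic_loop_l | eapply homotopic_loop_r]; eauto.
Qed.

(** * The Cantor set product *)

Lemma ccode_lt (l r : nat) : (ccode l r < 3 ^ l)%nat.
Proof.
  revert r. induction l as [|l IH]; intros r; cbn [ccode]; [simpl; lia|]. rewrite Nat.pow_succ_r'.
  specialize (IH (r / 2)%nat). pose proof (Nat.mod_upper_bound r 2 ltac:(lia)). lia.
Qed.

Lemma ccode_inj (l r r' : nat) : (r < 2 ^ l)%nat -> (r' < 2 ^ l)%nat ->
  ccode l r = ccode l r' -> r = r'.
Proof.
  revert r r'. induction l as [|l IH]; intros r r' H H'; [simpl in *; lia|].
  cbn [ccode]. simpl in H, H'.
  pose proof (Nat.div_mod_eq r 2). pose proof (Nat.div_mod_eq r' 2).
  pose proof (Nat.mod_upper_bound r 2 ltac:(lia)). pose proof (Nat.mod_upper_bound r' 2 ltac:(lia)).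
  intros E.
  assert (E1 : ccode l (r / 2) = ccode l (r' / 2)) by lia.
  apply IH in E1; lia.
Qed.

(* The [m] leading ternary digits of [ccode (d + m) r] form [ccode m (r / 2 ^ d)]. *)
Lemma ccode_leading (d m r : nat) :
  (3 ^ d * ccode m (r / 2 ^ d) <= ccode (d + m) r < 3 ^ d * (ccode m (r / 2 ^ d) + 1))%nat.
Proof.
  revert r. induction d as [|d IH]; intros r.
  - rewrite !Nat.pow_0_r, Nat.div_1_r. change (0 + m)%nat with m. lia.
  - change (S d + m)%nat with (S (d + m)). cbn [ccode]. specialize (IH (r / 2)%nat).
    rewrite Nat.Div0.div_div in IH. change (2 * 2 ^ d)%nat with (2 ^ S d)%nat in IH.
    pose proof (Nat.mod_upper_bound r 2 ltac:(lia)). rewrite (Nat.pow_succ_r' 3). lia.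
Qed.

(** All ternary digits of a code are 0 or 2. Thus the left end of a removed interval never starts
    with the digits of an earlier removed middle third. *)
Lemma ccode_last_digit (l k c : nat) : ccode (S l) k <> (3 * c + 1)%nat.
Proof.
  cbn [ccode]. pose proof (Nat.mod_upper_bound k 2 ltac:(lia)). lia.
Qed.

Lemma frac3_lt (A B p q : nat) : (A * 3 ^ q < B * 3 ^ p)%nat -> INR A / 3 ^ p < INR B / 3 ^ q.
Proof.
  intros H. apply lt_INR in H. rewrite !mult_INR, !pow_INR in H.
  replace (INR 3) with 3 in H by (simpl; lra).
  assert (Hp : 0 < 3 ^ p) by (apply pow_lt; lra). assert (Hq : 0 < 3 ^ q) by (apply pow_lt; lra).
  apply Rmult_lt_reg_r with (3 ^ p * 3 ^ q); [apply Rmult_lt_0_compat; auto|].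
  replace (INR A / 3 ^ p * (3 ^ p * 3 ^ q)) with (INR A * 3 ^ q) by (field; lra).
  replace (INR B / 3 ^ q * (3 ^ p * 3 ^ q)) with (INR B * 3 ^ p) by (field; lra). auto.
Qed.

Definition Rcan (l r : nat) : R := INR (3 * ccode l r + 2) / 3 ^ S l.

Lemma Lcan_S (l r : nat) : Lcan (S l) (S r) = INR (3 * ccode l r + 1) / 3 ^ S l.
Proof. unfold Lcan. do 2 f_equal. simpl. rewrite !Nat.sub_0_r. auto. Qed.

Lemma Lcan_Rcan (l r : nat) : Lcan (S l) (S r) + / 3 ^ S l = Rcan l r.
Proof.
  rewrite Lcan_S. unfold Rcan. rewrite !plus_INR. simpl (INR 1). simpl (INR 2).
  assert (0 < 3 ^ S l) by (apply pow_lt; lra). field. lra.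
Qed.

(** On one level the codes decide. On different levels, the leading digits [e] of the finer code
    differ from [3 c + 1], so [e] is at most [3 c] or at least [3 c + 2], and the finer interval
    lies on one side. The strict inequality separates the closed intervals. *)
Lemma tau_gap (l r l' r' : nat) : (r < 2 ^ l)%nat -> (r' < 2 ^ l')%nat -> (l, r) <> (l', r') ->
  Rcan l r < Lcan (S l') (S r') \/ Rcan l' r' < Lcan (S l) (S r).
Proof.
  assert (Same : forall l r r', (ccode l r < ccode l r')%nat -> Rcan l r < Lcan (S l) (S r')).
  { intros l0 s s' H. rewrite Lcan_S. unfold Rcan. apply frac3_lt. apply Nat.mul_lt_mono_pos_r; [|lia].
    apply Nat.neq_0_lt_0, Nat.pow_nonzero. lia. }
  assert (Diff : forall l r l' r', (l < l')%nat ->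
    Rcan l r < Lcan (S l') (S r') \/ Rcan l' r' < Lcan (S l) (S r)).
  { intros l0 s l1 s' H. rewrite !Lcan_S. unfold Rcan.
    assert (Hd : exists d, l1 = (d + S l0)%nat) by (exists (l1 - S l0)%nat; lia).
    destruct Hd as [d ->]. pose proof (ccode_leading d (S l0) s') as K.
    pose proof (ccode_last_digit l0 (s' / 2 ^ d) (ccode l0 s)) as N.
    set (e := ccode (S l0) (s' / 2 ^ d)) in *. set (c' := ccode (d + S l0) s') in *.
    set (c := ccode l0 s) in *. clearbody e c c'.
    replace (S (d + S l0)) with (S l0 + S d)%nat by lia.
    assert (Hw : (0 < 3 ^ S l0)%nat) by (apply Nat.neq_0_lt_0, Nat.pow_nonzero; lia).
    destruct (Nat.le_gt_cases e (3 * c)) as [L|L]; [right | left]; apply frac3_lt;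
      rewrite Nat.pow_add_r, (Nat.pow_succ_r' 3 d); set (w := (3 ^ S l0)%nat) in *; set (z := (3 ^ d)%nat) in *;
      clearbody w z.
    - assert (3 * c' + 2 < (3 * c + 1) * (3 * z))%nat by nia. nia.
    - assert ((3 * c + 2) * (3 * z) < 3 * c' + 1)%nat by nia. nia. }
  intros H H' N. destruct (Nat.lt_trichotomy l l') as [L|[L|L]].
  - apply Diff; auto.
  - subst l'. destruct (Nat.lt_trichotomy (ccode l r) (ccode l r')) as [K|[K|K]].
    + left. apply Same; auto.
    + exfalso. apply N. f_equal. eapply ccode_inj; eauto.
    + right. apply Same; auto.
  - destruct (Diff l' r' l r L); auto.
Qed.

(* The 0-based index [m] of the paper's loop placed on I_n^k satisfies [m + 1 = 2 ^ (n - 1) + (k - 1)]. *)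
Definition tau_level (m : nat) : nat := Nat.log2 (S m).
Definition tau_rank (m : nat) : nat := (S m - 2 ^ tau_level m)%nat.

Lemma tau_spec (m : nat) : (S m = 2 ^ tau_level m + tau_rank m /\ tau_rank m < 2 ^ tau_level m)%nat.
Proof.
  unfold tau_rank, tau_level. pose proof (Nat.log2_spec (S m) ltac:(lia)) as [H1 H2].
  rewrite Nat.pow_succ_r' in H2. lia.
Qed.

Lemma tau_level_rank (l r m : nat) : (r < 2 ^ l)%nat -> (S m = 2 ^ l + r)%nat ->
  tau_level m = l /\ tau_rank m = r.
Proof.
  intros H E. assert (L : tau_level m = l).
  { unfold tau_level. apply Nat.log2_unique; [lia|]. rewrite Nat.pow_succ_r'. lia. }
  split; auto. unfold tau_rank. rewrite L. lia.
Qed.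

Definition tau_left (m : nat) : R := Lcan (S (tau_level m)) (S (tau_rank m)).
Definition tau_right (m : nat) : R := Rcan (tau_level m) (tau_rank m).

Lemma tau_within : within tau_left tau_right.
Proof.
  intros m. unfold tau_left, tau_right. set (l := tau_level m). set (r := tau_rank m).
  assert (H3 : 0 < 3 ^ S l) by (apply pow_lt; lra).
  assert (Hi : 0 < / 3 ^ S l) by (apply Rinv_0_lt_compat; auto).
  split; [|split].
  - rewrite Lcan_S. apply Rmult_le_pos; [apply pos_INR | lra].
  - rewrite <- Lcan_Rcan. lra.
  - unfold Rcan. apply Rmult_le_reg_r with (3 ^ S l); auto.
    unfold Rdiv. rewrite Rmult_assoc, Rinv_l, Rmult_1_r, Rmult_1_l by lra.
    replace (3 ^ S l) with (INR (3 ^ S l)) by (rewrite pow_INR; f_equal; simpl; lra).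
    apply le_INR. pose proof (ccode_lt l r). rewrite Nat.pow_succ_r'. lia.
Qed.

Lemma tau_separated : separated tau_left tau_right.
Proof.
  intros m m' N. destruct (tau_spec m) as [E H]. destruct (tau_spec m') as [E' H'].
  destruct (tau_gap (tau_level m) (tau_rank m) (tau_level m') (tau_rank m')) as [K|K]; auto.
  - intros K. injection K; intros K1 K2. apply N. rewrite K1, K2 in E. lia.
  - left. apply Rlt_le, K.
  - right. apply Rlt_le, K.
Qed.

Lemma prod_tau_placed {X : Type} (x : X) (alpha : nat -> I -> X) :
  (forall n, alpha n I0 = x /\ alpha n I1 = x) ->
  placed x alpha tau_left tau_right (prod_tau x alpha).
Proof.
  intros HE.
  assert (V : forall m t, tau_left m <= val t <= tau_right m ->
    prod_tau x alpha t = alpha m (clampI (ramp (tau_left m) (tau_right m) (val t)))).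
  { intros m t Ht. destruct (tau_spec m) as [E H]. unfold prod_tau.
    destruct excluded_middle_informative as [h|h].
    - destruct constructive_indefinite_description as [[n k] [Hn [Hk Hnk]]]. cbn [proj1_sig fst snd] in *.
      destruct n as [|l]; [lia|]. destruct k as [|r]; [lia|].
      replace (S l - 1)%nat with l in * by lia. rewrite Lcan_Rcan in Hnk.
      (* The closed intervals are disjoint, so the chosen pair is the one coded by [m], and its
         index [2 ^ l + S r - 2] equals [m]. *)
      assert (Elr : (l, r) = (tau_level m, tau_rank m)).
      { destruct (excluded_middle_informative ((l, r) = (tau_level m, tau_rank m))) as [|N]; auto.
        exfalso. unfold tau_left, tau_right in Ht.
        destruct (tau_gap l r _ _ ltac:(lia) H N); lra. }
      injection Elr; intros Er El. subst r l.
      f_equal; [lia|]. f_equal. unfold ramp, tau_left, tau_right. rewrite <- Lcan_Rcan.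
      assert (0 < 3 ^ S (tau_level m)) by (apply pow_lt; lra). field. lra.
    - exfalso. apply h. exists (S (tau_level m), S (tau_rank m)). unfold piece_tau. cbn [fst snd].
      rewrite Lcan_Rcan. replace (S (tau_level m) - 1)%nat with (tau_level m) by lia.
      split; [lia|]. split; [lia|]. auto. }
  split.
  - intros m t Ht. apply V. lra.
  - intros t N. destruct (excluded_middle_informative (exists m, tau_left m <= val t <= tau_right m)) as [[m h]|h].
    + rewrite (V m t h). specialize (N m). pose proof (tau_within m) as W.
      destruct (Rle_dec (val t) (tau_left m)).
      * rewrite clampI_le0 by (apply ramp_le0; lra). apply HE.
      * rewrite clampI_ge1 by (apply ramp_ge1; lra). apply HE.
    + unfold prod_tau. destruct excluded_middle_informative as [[[n k] [Hn [Hk Hnk]]]|]; auto.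
      exfalso. apply h. cbn [fst snd] in *.
      destruct n as [|l]; [lia|]. destruct k as [|r]; [lia|].
      replace (S l - 1)%nat with l in * by lia.
      destruct (tau_level_rank l r (2 ^ l + r - 1) ltac:(lia) ltac:(lia)) as [E1 E2].
      exists (2 ^ l + r - 1)%nat. unfold tau_left, tau_right. rewrite E1, E2, <- Lcan_Rcan. auto.
Qed.

(** Permuting the factors by [phi] amounts to placing the unpermuted [alpha n] on the interval of
    index [psi n], where [psi] is the inverse of [phi]. *)
Theorem transf_comm_of_factor {X : Type} (opn : (X -> Prop) -> Prop) (x : X) :
  cond_factor opn x -> transf_comm opn x.
Proof.
  intros HC alpha Ha phi [Hinj Hsurj].
  pose proof (loop_endpoints opn x alpha Ha) as HE.
  set (psi := fun n => proj1_sig (constructive_indefinite_description _ (Hsurj n))).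
  assert (E1 : forall n, phi (psi n) = n).
  { intros n. unfold psi. destruct constructive_indefinite_description; auto. }
  assert (E2 : forall n, psi (phi n) = n) by (intros n; apply Hinj, E1).
  assert (Npsi : forall i j, i <> j -> psi i <> psi j).
  { intros i j N K. apply N. rewrite <- (E1 i), <- (E1 j), K. auto. }
  apply (placed_homotopic_of_factor opn x alpha tau_left tau_right
    (fun n => tau_left (psi n)) (fun n => tau_right (psi n))); auto.
  - apply tau_within.
  - apply tau_separated.
  - intros n. apply tau_within.
  - intros i j N. apply tau_separated; auto.
  - apply prod_tau_placed; auto.
  - destruct (prod_tau_placed x (fun n => alpha (phi n))) as [P1 P2]; auto.
    split.
    + intros n t Ht. rewrite (P1 (psi n)), E1 by auto. auto.
    + intros t N. apply P2. intros n. specialize (N (phi n)). rewrite E2 in N. auto.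
Qed.

(* The rightmost interval of each level of the Cantor set: these have order type omega. *)
Definition spot (j : nat) : nat := (2 ^ S j - 2)%nat.

Lemma spot_mono (i j : nat) : (i < j)%nat -> (spot i < spot j)%nat.
Proof.
  intros H. unfold spot. assert (2 ^ S i < 2 ^ S j)%nat by (apply Nat.pow_lt_mono_r; lia).
  assert (0 < 2 ^ i)%nat by (apply Nat.neq_0_lt_0, Nat.pow_nonzero; lia).
  rewrite (Nat.pow_succ_r' 2 i) in *. lia.
Qed.

Lemma spot_inj (i j : nat) : spot i = spot j -> i = j.
Proof.
  intros E. destruct (Nat.lt_trichotomy i j) as [L|[L|L]]; auto; apply spot_mono in L; lia.
Qed.

Lemma ccode_max (j : nat) : S (ccode j (2 ^ j - 1)) = (3 ^ j)%nat.
Proof.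
  induction j as [|j IH]; auto. cbn [ccode].
  assert (P : (0 < 2 ^ j)%nat) by (apply Nat.neq_0_lt_0, Nat.pow_nonzero; lia).
  assert (E : (2 ^ S j - 1 = 2 * (2 ^ j - 1) + 1)%nat) by (rewrite Nat.pow_succ_r'; lia).
  rewrite E. replace ((2 * (2 ^ j - 1) + 1) mod 2)%nat with 1%nat.
  - replace ((2 * (2 ^ j - 1) + 1) / 2)%nat with (2 ^ j - 1)%nat; [rewrite (Nat.pow_succ_r' 3); lia|].
    apply Nat.div_unique with 1%nat; lia.
  - apply Nat.mod_unique with (2 ^ j - 1)%nat; lia.
Qed.

Lemma spot_level_rank (j : nat) : tau_level (spot j) = j /\ tau_rank (spot j) = (2 ^ j - 1)%nat.
Proof.
  assert (P : (0 < 2 ^ j)%nat) by (apply Nat.neq_0_lt_0, Nat.pow_nonzero; lia).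
  apply tau_level_rank; [lia|]. unfold spot. rewrite Nat.pow_succ_r'. lia.
Qed.

(** With all ternary digits equal to 2, the intervals run from [1 - 2 / 3^(j+1)] to
    [1 - 1 / 3^(j+1)]. *)
Lemma spot_consecutive : consecutive (fun j => tau_left (spot j)) (fun j => tau_right (spot j)).
Proof.
  intros i j H. unfold tau_left, tau_right.
  destruct (spot_level_rank i) as [-> ->]. destruct (spot_level_rank j) as [-> ->].
  rewrite Lcan_S. unfold Rcan. left. apply frac3_lt.
  pose proof (ccode_max i) as Ei. pose proof (ccode_max j) as Ej.
  set (c := ccode i (2 ^ i - 1)) in *. set (c' := ccode j (2 ^ j - 1)) in *. clearbody c c'.
  assert (Hd : exists d, j = (d + S i)%nat) by (exists (j - S i)%nat; lia). destruct Hd as [d ->].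
  rewrite (Nat.pow_succ_r' 3 (d + S i)), (Nat.pow_succ_r' 3 i).
  rewrite Nat.pow_add_r, (Nat.pow_succ_r' 3 i), <- Ei in *.
  assert (P : (0 < 3 ^ d)%nat) by (apply Nat.neq_0_lt_0, Nat.pow_nonzero; lia).
  set (z := (3 ^ d)%nat) in *. clearbody z. nia.
Qed.

Definition spread {Y : Type} (y : Y) (alpha : nat -> Y) (m : nat) : Y :=
  match excluded_middle_informative (exists j, m = spot j) with
  | left h => alpha (proj1_sig (constructive_indefinite_description _ h))
  | right _ => y
  end.

Lemma spread_spot {Y : Type} (y : Y) (alpha : nat -> Y) (j : nat) : spread y alpha (spot j) = alpha j.
Proof.
  unfold spread. destruct excluded_middle_informative as [h|h]; [|exfalso; eauto].
  destruct constructive_indefinite_description as [i Hi]. cbn. apply spot_inj in Hi. subst; auto.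
Qed.

Lemma spread_off {Y : Type} (y : Y) (alpha : nat -> Y) (m : nat) :
  (forall j, m <> spot j) -> spread y alpha m = y.
Proof.
  intros H. unfold spread. destruct excluded_middle_informative as [[j h]|]; auto. exfalso; eapply H; eauto.
Qed.

Lemma spot_dec (m : nat) : (exists j, m = spot j) \/ forall j, m <> spot j.
Proof.
  destruct (excluded_middle_informative (exists j, m = spot j)); eauto.
Qed.

(** * Omega-products as Cantor products with constant factors *)

Section Spread.
Context {X : Type} (opn : (X -> Prop) -> Prop) (x : X).

Lemma spread_null (alpha : nat -> I -> X) : null_seq opn x alpha -> null_seq opn x (spread (fun _ => x) alpha).
Proof.
  intros [H1 H2]. split.
  - intros m. destruct (spot_dec m) as [[j ->]|N].
    + rewrite spread_spot. auto.
    + rewrite spread_off by auto. apply loop_const. auto.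
  - intros U HU Ux. destruct (H2 U HU Ux) as [N HN]. exists (spot N). intros m Hm t.
    destruct (spot_dec m) as [[j ->]|N'].
    + rewrite spread_spot. apply HN. destruct (Nat.le_gt_cases N j) as [|L]; auto. apply spot_mono in L. lia.
    + rewrite spread_off by auto. auto.
Qed.

Lemma prod_tau_spread (alpha : nat -> I -> X) : null_seq opn x alpha ->
  homotopic opn (fun _ => True) x (prod_tau x (spread (fun _ => x) alpha)) (prod_inf x alpha).
Proof.
  intros Ha. pose proof (loop_endpoints opn x _ Ha) as HE.
  pose proof (loop_endpoints opn x _ (spread_null alpha Ha)) as HE'.
  apply (homotopic_placed_reorder opn x alpha (fun j => tau_left (spot j)) (fun j => tau_right (spot j))
    el (fun n => el (S n))); auto.
  - intros j. apply tau_within.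
  - apply el_within.
  - apply consecutive_same_order; [apply spot_consecutive | apply el_consecutive].
  - destruct (prod_tau_placed x _ HE') as [P1 P2]. split.
    + intros j t Ht. rewrite (P1 (spot j)), spread_spot by auto. auto.
    + intros t N. destruct (excluded_middle_informative (exists m, tau_left m < val t < tau_right m)) as [[m h]|h].
      * rewrite (P1 m) by auto. destruct (spot_dec m) as [[j ->]|N']; [exfalso; eapply N; eauto|].
        rewrite spread_off; auto.
      * apply P2. eauto.
  - apply prod_inf_placed. intros; apply HE.
Qed.

Theorem inf_comm_of_transf_comm : transf_comm opn x -> inf_comm opn x.
Proof.
  intros HT alpha Ha phi [Hinj Hsurj].
  assert (Ha' : null_seq opn x (fun n => alpha (phi n))).
  { destruct Ha as [H1 H2]. split; auto. intros U HU Ux. destruct (H2 U HU Ux) as [N HN].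
    (* A permuted null sequence is null because an injective [phi] takes each of the finitely many
       values below [N] only once. *)
    assert (Hb : exists B, forall n, (B <= n)%nat -> (N <= phi n)%nat).
    { clear HN. induction N as [|N [B HB]]; [exists 0%nat; lia|].
      destruct (Hsurj N) as [k Hk]. exists (B + S k)%nat. intros n Hn.
      specialize (HB n ltac:(lia)). assert (phi n <> N); [|lia]. intros E. rewrite <- Hk in E.
      apply Hinj in E. lia. }
    destruct Hb as [B HB]. exists B. auto. }
  (* The permutation [phi] is transported to the spots and extended by the identity, so that it
     moves no constant factor. *)
  set (psi := fun m => match excluded_middle_informative (exists j, m = spot j) with
    | left h => spot (phi (proj1_sig (constructive_indefinite_description _ h)))
    | right _ => m end).
  assert (Pon : forall j, psi (spot j) = spot (phi j)).
  { intros j. unfold psi. destruct excluded_middle_informative as [h|h]; [|exfalso; eauto].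
    destruct constructive_indefinite_description as [i Hi]. cbn. apply spot_inj in Hi. subst; auto. }
  assert (Poff : forall m, (forall j, m <> spot j) -> psi m = m).
  { intros m H. unfold psi. destruct excluded_middle_informative as [[j h]|]; auto. exfalso; eapply H; eauto. }
  eapply homotopic_trans; [apply homotopic_sym, prod_tau_spread; auto|].
  eapply homotopic_trans; [|apply prod_tau_spread; auto].
  replace (spread (fun _ => x) (fun n => alpha (phi n))) with (fun m => spread (fun _ : I => x) alpha (psi m)).
  - apply HT; [apply spread_null; auto|]. split.
    + intros m n. destruct (spot_dec m) as [[i ->]|M], (spot_dec n) as [[j ->]|N];
        rewrite ?Pon, ?(Poff m), ?(Poff n) by auto; auto.
      * intros E. apply spot_inj, Hinj in E. subst; auto.
      * intros E. exfalso. eapply N; eauto.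
      * intros E. exfalso. eapply M; eauto.
    + intros n. destruct (spot_dec n) as [[j ->]|N].
      * destruct (Hsurj j) as [i <-]. exists (spot i). auto.
      * exists n. auto.
  - extensionality m. destruct (spot_dec m) as [[j ->]|N].
    + rewrite Pon, !spread_spot. auto.
    + rewrite Poff, !spread_off by auto. auto.
Qed.

End Spread.

Theorem mainTheorem3 (X : Type) (opn : (X -> Prop) -> Prop)
  (Htop : is_topology opn) (x : X) :
  (cond_factor opn x <-> transf_comm opn x) /\
  (transf_comm opn x <-> inf_comm opn x).
Proof.
  pose proof (transf_comm_of_factor opn x) as H12.
  pose proof (inf_comm_of_transf_comm opn x) as H23.
  pose proof (factor_of_inf_comm opn x) as H31.
  tauto.
Qed.
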